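(* $\mathsf{ZP}_\tau\mathsf{CL}=\mathsf{ZP}_\tau\mathsf{CL}\mathsf{P}$.
   Context: A catalytic-type machine has a read-only input tape, a write-only output tape, a read-write work tape and a read-write catalytic tape initially holding an arbitrary string $\tau$. $L\in\mathsf{ZP}_\tau\mathsf{CSPACE}[s,c]$ if some deterministic such machine with work space $s$ and catalytic space $c$ always halts with its initial catalytic content $\tau$ restored, and on every input $x$ outputs either $L(x)$ or a special symbol $\perp$ (never the wrong answer), outputting $L(x)$ for at least half of all initial tapes $\tau\in\{0,1\}^c$. $\mathsf{ZP}_\tau\mathsf{CL}=\bigcup_{k}\mathsf{ZP}_\tau\mathsf{CSPACE}[k\log n,n^k]$, and $\mathsf{ZP}_\tau\mathsf{CL}\mathsf{P}$ is the subclass where for some $k$ the machine (with $k\log n$ work bits and $n^k$ catalytic bits) additionally always halts within $n^k$ steps. *)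

(* Defs.v *)
From mathcomp Require Import all_boot.
Unset Printing Implicit Defensive.

Inductive move := mvL | mvS | mvR.

(** A catalytic machine: finite control, read-only binary input tape,
    binary read-write work tape, binary read-write catalytic tape.
    Every tape has end-markers at cells 0 and len+1 (read as [None]);
    cells 1..len hold the content.  The (write-only) output is modelled by
    halting states labelled with the output symbol:
    [halt_out q = Some (Some b)] outputs [b], [halt_out q = Some None] outputs
    the special symbol ⊥, [halt_out q = None] means [q] is not halting.
    [trans q i w c = (q', wb, cb, mi, mw, mc)]: new state, bit written on the
    work cell, bit written on the catalytic cell, and moves of the three heads. *)
Record CatTM := {
  st : finType;
  start : st;
  halt_out : st -> option (option bool);
  trans : st -> option bool -> option bool -> option bool ->
          st * bool * bool * move * move * move
}.

Record config (Q : Type) := Config {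
  cst : Q; ipos : nat; wpos : nat; cpos : nat;
  wtape : seq bool; ctape : seq bool }.
Arguments cst {Q}. Arguments ipos {Q}. Arguments wpos {Q}. Arguments cpos {Q}.
Arguments wtape {Q}. Arguments ctape {Q}. Arguments Config {Q}.

Definition read (t : seq bool) (p : nat) : option bool :=
  if (0 < p) && (p <= size t) then Some (nth false t p.-1) else None.

Definition write (t : seq bool) (p : nat) (b : bool) : seq bool :=
  if (0 < p) && (p <= size t) then set_nth false t p.-1 b else t.

Definition do_move (len p : nat) (m : move) : nat :=
  match m with mvL => p.-1 | mvS => p | mvR => minn p.+1 len.+1 end.

Definition step (M : CatTM) (x : seq bool) (c : config (st M)) : config (st M) :=
  if halt_out M (cst c) is Some _ then c else
  let: (q', wb, cb, mi, mw, mc) :=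
     trans M (cst c) (read x (ipos c)) (read (wtape c) (wpos c))
             (read (ctape c) (cpos c)) in
  Config q' (do_move (size x) (ipos c) mi)
            (do_move (size (wtape c)) (wpos c) mw)
            (do_move (size (ctape c)) (cpos c) mc)
            (write (wtape c) (wpos c) wb) (write (ctape c) (cpos c) cb).

Definition init (M : CatTM) (s : nat) (tau : seq bool) : config (st M) :=
  Config (start M) 0 0 0 (nseq s false) tau.

Definition run (M : CatTM) (x : seq bool) (s : nat) (tau : seq bool) (t : nat)
  : config (st M) := iter t (step M x) (init M s tau).

Definition halted (M : CatTM) (c : config (st M)) : Prop :=
  halt_out M (cst c) <> None.

Definition halts_restores_with (M : CatTM) (x : seq bool) (s : nat)
    (tau : seq bool) (t : nat) (o : option bool) : Prop :=
  let c := run M x s tau t in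
  halt_out M (cst c) = Some o /\ ctape c = tau.

Definition ZP_decides (M : CatTM) (s c : nat -> nat) (L : pred (seq bool))
  : Prop :=
  forall x : seq bool,
    (forall tau : (c (size x)).-tuple bool,
       exists t o, halts_restores_with M x (s (size x)) tau t o /\
                   (o = None \/ o = Some (L x)))
    /\ exists A : {set (c (size x)).-tuple bool},
         2 ^ c (size x) <= 2 * #|A| /\
         forall tau, tau \in A ->
           exists t, halts_restores_with M x (s (size x)) tau t (Some (L x)).

Definition ZPtauCSPACE (s c : nat -> nat) (L : pred (seq bool)) : Prop :=
  exists M : CatTM, ZP_decides M s c L.

Definition nn (n : nat) : nat := maxn n 2.
Definition logspace (k : nat) (n : nat) : nat := k * up_log 2 (nn n).
Definition polybound (k : nat) (n : nat) : nat := nn n ^ k.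

Definition ZPtauCL (L : pred (seq bool)) : Prop :=
  exists k, ZPtauCSPACE (logspace k) (polybound k) L.

Definition ZPtauCLP (L : pred (seq bool)) : Prop :=
  exists k (M : CatTM),
    ZP_decides M (logspace k) (polybound k) L /\
    forall (x : seq bool) (tau : (polybound k (size x)).-tuple bool),
      halted M (run M x (logspace k (size x)) tau (polybound k (size x))).

(* Main.v *)
Require Import Defs.
From mathcomp Require Import all_boot.
From HB Require Import structures.
From mathcomp Require Import zify.

(** Let [M] decide [L] with [C = nn n ^ k] catalytic cells.  On an input [x] the
    configurations of [M] form in-trees rooted at halting configurations, and the
    trees of different initial catalytic contents are disjoint, since a computation
    ends with its own initial content.  As there are [2 ^ C] contents and only
    [2 ^ C * poly n] configurations, all but an eighth of the contents lie in a tree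
    of polynomial size.  An Euler tour of the tree is reversible and locally
    computable: follow it for [N = poly n] steps, note the answer if the root is met,
    then follow it backwards for [N] steps, which restores the tape whether or not the
    root was met.  This fails for at most 5/8 of the contents; running it on two
    disjoint blocks of a longer catalytic tape fails for at most 25/64 < 1/2. *)

Set Implicit Arguments.
Unset Strict Implicit.
Unset Printing Implicit Defensive.

(** * Machines that sweep their work tape *)

(** One exponent has to bound work space, catalytic space and time at once, and the simulator learns
    about [n] only from its tapes. It therefore reads its work tape as [B.+1 * l] columns, [l] being
    the rounded logarithm, and lets its registers fill all of them: [N = 2 ^ (B.+1 * l)] is then
    just the value at which the round counter overflows, and no polynomial has to be computed for
    it. The constant [B] is chosen so that [N] is at least eight times the number of darts per
    catalytic content.

    A second obstacle is that the catalytic tape of [M] becomes a block of a longer tape and loses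
    its end markers; one register holding the head position and one holding the block length plus
    one replace them.

    Two blocks are needed because success is granted on only half of the contents, so that the
    eighth lost to large trees cannot be absorbed. Their answers are merged without a vote: [M]
    never errs, so any answer other than ⊥ is right. *)

Definition move_code (m : move) : option bool :=
  match m with mvL => Some false | mvS => None | mvR => Some true end.
Definition move_decode (o : option bool) : move :=
  match o with Some false => mvL | None => mvS | Some true => mvR end.
Lemma move_codeK : cancel move_code move_decode.
Proof. by case. Qed.
HB.instance Definition _ := Finite.copy move (can_type move_codeK).

Lemma size_write t p b : size (write t p b) = size t.
Proof.
rewrite /write; case: ifP => // /andP[p0 pt].
by rewrite size_set_nth; apply/maxn_idPr; rewrite prednK.
Qed.

Lemma write_read t p : write t p (odflt false (read t p)) = t.
Proof.
rewrite /write /read; case: ifP => //= /andP[p0 pt].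
apply: (@eq_from_nth _ false) => [|i it].
  by rewrite size_set_nth; apply/maxn_idPr; rewrite prednK.
by rewrite nth_set_nth /= p0 pt; case: eqP => [->|_].
Qed.

Lemma read_cat_cons (u v : seq bool) b : read (u ++ b :: v) (size u).+1 = Some b.
Proof. by rewrite /read /= size_cat /= nth_cat ltnn subnn /= ifT //; lia. Qed.

Lemma read_oversize (u : seq bool) : read u (size u).+1 = None.
Proof. by rewrite /read ltnn andbF. Qed.

Lemma write_cat_cons (u v : seq bool) b c :
  write (u ++ b :: v) (size u).+1 c = u ++ c :: v.
Proof.
rewrite /write /= size_cat /= ifT; last by lia.
apply: (@eq_from_nth _ false) => [|i].
  by rewrite size_set_nth !size_cat /=; apply/maxn_idPr; lia.
move=> _; rewrite nth_set_nth /= !nth_cat; case: ltngtP => // [|->]; last by rewrite subnn.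
by move=> h; rewrite -(subnKC h) addSnnS addKn.
Qed.

Section Transducers.
Variables S A : Type.
Implicit Type d : S -> A -> S * A.

Fixpoint trl d s (w : seq A) : S * seq A :=
  if w is a :: w' then
    let: (s1, a1) := d s a in let: (s2, w2) := trl d s1 w' in (s2, a1 :: w2)
  else (s, [::]).

Fixpoint trr d s (w : seq A) : S * seq A :=
  if w is a :: w' then
    let: (s1, w1) := trr d s w' in let: (s2, a2) := d s1 a in (s2, a2 :: w1)
  else (s, [::]).

Lemma trl_cat d s u v :
  trl d s (u ++ v) =
    ((trl d (trl d s u).1 v).1, (trl d s u).2 ++ (trl d (trl d s u).1 v).2).
Proof.
elim: u s => [|a u IH] s /=; first by case: trl.
by case: (d s a) => s1 a1; rewrite IH; case: (trl d s1 u) => /= s2 u2; case: trl.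
Qed.

Lemma trr_cat d s u v :
  trr d s (u ++ v) =
    ((trr d (trr d s v).1 u).1, (trr d (trr d s v).1 u).2 ++ (trr d s v).2).
Proof.
elim: u => [|a u IH] /=; first by case: trr.
by rewrite IH; case: (trr d _ u) => /= s2 u2; case: (d s2 a).
Qed.

Lemma size_trl d s u : size (trl d s u).2 = size u.
Proof. by elim: u s => //= a u IH s; case: (d s a) => s1 a1; rewrite -(IH s1); case: trl. Qed.

Lemma size_trr d s u : size (trr d s u).2 = size u.
Proof. by elim: u => //= a u <-; case: trr => s1 u1; case: (d s1 a). Qed.

End Transducers.

Section SweepTM.

Variables (F : finType) (f0 : F) (fout : F -> option (option bool)).
Variable home : F -> option bool -> option bool -> F * bool * move * move.
Variables fwd bwd : F -> bool -> F * bool.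

(* Second component: [None] at the left end of the work tape, [Some true] during
   the sweep to the right, [Some false] during the sweep back. *)
Definition sweepTM : CatTM := {|
  st := (F * option bool)%type;
  start := (f0, None);
  halt_out := fun q => if q.2 is None then fout q.1 else None;
  trans := fun q i w c =>
    match q.2, w with
    | None, _ => let: (f, cb, mi, mc) := home q.1 i c in
        ((f, Some true), odflt false w, cb, mi, mvR, mc)
    | Some true, Some b => let: (f, b') := fwd q.1 b in
        ((f, Some true), b', odflt false c, mvS, mvR, mvS)
    | Some true, None => ((q.1, Some false), false, odflt false c, mvS, mvL, mvS)
    | Some false, Some b => let: (f, b') := bwd q.1 b in
        ((f, Some false), b', odflt false c, mvS, mvL, mvS)
    | Some false, None => ((q.1, None), false, odflt false c, mvS, mvS, mvS)
    end |}.

Record mcfg := MCfg { mf : F; mip : nat; mcp : nat; mw : seq bool; mct : seq bool }.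

Definition mstep (x : seq bool) (c : mcfg) : mcfg :=
  if fout (mf c) is Some _ then c else
  let: (f1, cb, mi, mc) := home (mf c) (read x (mip c)) (read (mct c) (mcp c)) in
  let: (f2, w2) := trl fwd f1 (mw c) in
  let: (f3, w3) := trr bwd f2 w2 in
  MCfg f3 (do_move (size x) (mip c) mi) (do_move (size (mct c)) (mcp c) mc)
       w3 (write (mct c) (mcp c) cb).

Definition of_mcfg (c : mcfg) : config (st sweepTM) :=
  @Config (st sweepTM) (mf c, None) (mip c) 0 (mcp c) (mw c) (mct c).

Variable x : seq bool.

Lemma sweep_right f ip cp u w ct :
  iter (size w) (step sweepTM x)
    (@Config (st sweepTM) (f, Some true) ip (size u).+1 cp (u ++ w) ct) =
  @Config (st sweepTM) ((trl fwd f w).1, Some true) ip (size (u ++ w)).+1 cp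
    (u ++ (trl fwd f w).2) ct.
Proof.
elim: w f u => [|b w IH] f u; first by rewrite /= !cats0.
rewrite [size _]/= iterSr {2}/step /= read_cat_cons.
case E: (fwd f b) => [f1 b1] /=; rewrite write_cat_cons write_read.
rewrite (_ : minn _ _ = (size (rcons u b1)).+1); last by rewrite size_rcons size_cat /=; lia.
rewrite -cat_rcons IH; case: (trl _ f1 w) => f2 w2 /=.
by rewrite !cat_rcons !size_cat.
Qed.

Lemma sweep_left f ip cp u w ct :
  iter (size w) (step sweepTM x)
    (@Config (st sweepTM) (f, Some false) ip (size w) cp (w ++ u) ct) =
  @Config (st sweepTM) ((trr bwd f w).1, Some false) ip 0 cp
    ((trr bwd f w).2 ++ u) ct.
Proof.
elim/last_ind: w f u => [|w b IH] f u //.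
rewrite size_rcons iterSr {2}/step /= cat_rcons read_cat_cons.
rewrite -cats1 trr_cat /=.
by case E: (bwd f b) => [f1 b1] /=; rewrite write_cat_cons write_read IH /= -catA.
Qed.

(** The count is one step at home, a sweep, one turn at the right marker, the sweep back, and one
    turn at the left marker. It depends only on the length of the work tape, and a halted machine
    idles through it, so macro steps can simply be multiplied. *)
Lemma sweepTM_macro c :
  iter (2 * size (mw c) + 3) (step sweepTM x) (of_mcfg c) = of_mcfg (mstep x c).
Proof.
rewrite /mstep; case E: (fout (mf c)) => [o|].
  by elim: (2 * _ + 3) => //= n ->; rewrite /step /= E.
have -> : 2 * size (mw c) + 3 = 1 + (size (mw c) + (1 + (size (mw c) + 1))) by lia.
rewrite [LHS]iterD iterD iterD iterD.
case: c E => f ip cp w ct /= E.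
rewrite {5}/step /= E; case: home => [[[f1 cb] mi] mc] /=.
rewrite (_ : write w 0 _ = w) // (_ : minn 1 _ = (size (Nil bool)).+1); last by rewrite /=; lia.
rewrite (sweep_right f1 _ _ [::] w) cat0s.
case E2: (trl fwd f1 w) => [f2 w2] /=.
have s2 : size w2 = size w by rewrite -(size_trl fwd f1 w) E2.
rewrite -s2 {3}/step /= read_oversize /= write_read.
rewrite (_ : write w2 _ _ = w2); last by rewrite /write ltnn andbF.
rewrite -[X in Config _ _ _ _ X _]cats0 sweep_left cats0.
by case: (trr bwd f2 w2) => f3 w3; rewrite /step /= write_read.
Qed.

Lemma size_mstep c : size (mw (mstep x c)) = size (mw c).
Proof.
rewrite /mstep; case: fout => // ; case: home => [[[f1 cb] mi] mc].
rewrite -(size_trl fwd f1 (mw c)); case: trl => f2 w2.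
by rewrite -(size_trr bwd f2 w2); case: trr.
Qed.

Lemma sweepTM_iter t c :
  iter (t * (2 * size (mw c) + 3)) (step sweepTM x) (of_mcfg c) =
  of_mcfg (iter t (mstep x) c).
Proof.
elim: t c => // t IH c; rewrite mulSn addnC iterD sweepTM_macro iterSr -IH.
by rewrite size_mstep.
Qed.

End SweepTM.

(** * Registers and a virtual work tape on the columns of the work tape *)

(** The roles of the seven cells of a column: activity, mark of the virtual head, virtual work cell,
    one binary digit each of the registers [X], [V], [T], and a second copy of the activity bit. *)
Inductive track := TA | TM | TC | TX | TV | TT | TE.

Definition track_code (r : track) : 'I_7 :=
  match r with
  | TA => @inord 6 0 | TM => @inord 6 1 | TC => @inord 6 2 | TX => @inord 6 3
  | TV => @inord 6 4 | TT => @inord 6 5 | TE => @inord 6 6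
  end.
Definition track_decode (i : 'I_7) : track := nth TA [:: TA; TM; TC; TX; TV; TT; TE] i.
Lemma track_codeK : cancel track_code track_decode.
Proof. by case; rewrite /track_decode /= inordK. Qed.
HB.instance Definition _ := Finite.copy track (can_type track_codeK).

Definition tnext (r : track) : track :=
  match r with TA => TM | TM => TC | TC => TX | TX => TV | TV => TT | TT => TE | TE => TA end.
Definition tprev (r : track) : track :=
  match r with TA => TE | TM => TA | TC => TM | TX => TC | TV => TX | TT => TV | TE => TT end.

(* What a head sees, with the two end markers told apart:
   [inl false] is the left one, [inl true] the right one. *)
Definition hsym := (bool + bool)%type.

Definition eread (t : seq bool) (p : nat) : hsym :=
  if p == 0 then inl false else if p <= size t then inr (nth false t p.-1) else inl true.

Lemma ereadE t p :
  eread t p = if 0 < p <= size t then inr (nth false t p.-1) else inl (p != 0).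
Proof. by rewrite /eread; case: p => //= p; case: ifP. Qed.

Definition forget (e : hsym) : option bool := if e is inr b then Some b else None.

(** A move that an end marker blocks is recorded as a stay. Effective moves are never clamped, hence
    have exact inverses. *)
Definition eff (e : hsym) (m : move) : move :=
  match e, m with inl false, mvL => mvS | inl true, mvR => mvS | _, _ => m end.

Lemma forget_eread t p : forget (eread t p) = read t p.
Proof. by rewrite /eread /read; case: p => //= p; case: ifP. Qed.

Definition umove (p : nat) (m : move) : nat :=
  match m with mvL => p.-1 | mvS => p | mvR => p.+1 end.

Lemma do_move_eff t p m : p <= (size t).+1 ->
  do_move (size t) p m = umove p (eff (eread t p) m).
Proof.
rewrite /eread; case: p => [|p] /=; first by case: m => //=; lia.
by case: ifP => h1 h2; case: m => //=; lia.
Qed.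

Lemma do_move_le len p m : p <= len.+1 -> do_move len p m <= len.+1.
Proof. by case: m => //=; lia. Qed.

Record col := Col { ka : bool; km : bool; kc : bool; kx : bool; kv : bool; kt : bool }.

(* [ka] is stored at both ends of the column because both sweeps must know it
   before they meet the mark. *)
Definition bits (c : col) : seq bool :=
  [:: ka c; km c; kc c; kx c; kv c; kt c; ka c].

Definition wcells (cols : seq col) : seq (bool * bool) :=
  [seq (km c, kc c) | c <- cols & ka c].

Fixpoint num (f : col -> bool) (cols : seq col) : nat :=
  if cols is c :: cols' then f c + 2 * num f cols' else 0.

Lemma num_lt f cols : num f cols < 2 ^ size cols.
Proof. by elim: cols => //= c cols IH; rewrite expnS; case: (f c) => /=; lia. Qed.

(** Positions [0] and [(size t).+1] both leave all cells unmarked; which end is meant is remembered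
    in the finite control as an [hsym]. *)
Fixpoint wenc (p : nat) (t : seq bool) : seq (bool * bool) :=
  if t is b :: t' then (p == 1, b) :: wenc p.-1 t' else [::].

(** A mark can be carried only in the direction of the sweep: the way out writes and performs moves
    to the right, the way back performs moves to the left and picks up the symbol under the new
    mark. *)
Definition wfwd (wb : bool) (mw : move) (pend : bool) (c : bool * bool) :=
  let: (m, b) := c in
  let rt := mw == mvR in
  (if rt then m else pend,
   (if rt then (if m then false else pend) else m, if m then wb else b)).

Definition wbwd (mw : move) (s : bool * hsym) (c : bool * bool) :=
  let: (m, b) := c in
  let lf := mw == mvL in
  let m' := if lf then (if m then false else s.1) else m in
  ((if lf then m else s.1, if m' then inr b else s.2), (m', b)).

Lemma wenc0_fwd wb mw t : trl (wfwd wb mw) false (wenc 0 t) = (false, wenc 0 t).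
Proof. by elim: t => //= b t IH; rewrite !if_same IH. Qed.

Lemma wenc_fwd_stay wb mw pend p t : mw != mvR ->
  trl (wfwd wb mw) pend (wenc p t) = (pend, wenc p (write t p wb)).
Proof.
move=> /negbTE hm; elim: t p => [|b t IH] p; first by rewrite /write /= ifN //; lia.
rewrite /= hm IH; case: p => [|[|p]] //=.
by rewrite /write /= ltnS; case: ifP.
Qed.

Lemma wenc_fwd_right wb p t : 0 < p <= size t ->
  trl (wfwd wb mvR) false (wenc p t) = (p == size t, wenc p.+1 (write t p wb)).
Proof.
elim: t p => [|b t IH] [|[|p]] //= h.
- by case: t {IH h} => [|b' t] //=; rewrite wenc0_fwd.
- rewrite IH; last by lia.
  by rewrite /write /= eqSS ltnS; case: ifP.
Qed.

Lemma wenc_fwd_enter wb t :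
  trl (wfwd wb mvR) true (wenc 0 t) = (size t == 0, wenc 1 t).
Proof. by case: t => //= b t; rewrite wenc0_fwd. Qed.

Lemma wenc_bwd_stay mw pend ws p t : mw != mvL ->
  trr (wbwd mw) (pend, ws) (wenc p t) =
  ((pend, if 0 < p <= size t then inr (nth false t p.-1) else ws), wenc p t).
Proof.
move=> /negbTE hm; elim: t p => [|b t IH] p /=; first by rewrite ifN //; lia.
by rewrite IH hm /=; case: p => [|[|p]] //=; rewrite ltnS; case: ifP.
Qed.

Lemma wenc0_bwd mw ws t : trr (wbwd mw) (false, ws) (wenc 0 t) = ((false, ws), wenc 0 t).
Proof. by elim: t => //= b t IH; rewrite IH /= !if_same. Qed.

Lemma wenc_bwd_left ws p t : 0 < p <= (size t).+1 ->
  trr (wbwd mvL) (p == (size t).+1, ws) (wenc p t) =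
  ((p == 1, if 1 < p then inr (nth false t p.-2) else ws), wenc p.-1 t).
Proof.
elim: t p => [|b t IH] [|[|p]] //= h; first by rewrite wenc0_bwd.
by rewrite eqSS IH; [case: p h => [|p] h //=|lia].
Qed.

(* [pend] carries a pending mark across an end marker or a cell boundary. *)
Lemma wenc_sweeps wb mw p t : p <= (size t).+1 ->
  let e := eread t p in
  let m := eff e mw in
  let pend := ((m == mvR) && (e == inl false)) || ((m == mvL) && (e == inl true)) in
  let ws := match m with mvL => inl false | mvS => e | mvR => inl true end in
  let r1 := trl (wfwd wb m) pend (wenc p t) in
  let r2 := trr (wbwd m) (r1.1, ws) r1.2 in
  let t' := write t p wb in
  let p' := do_move (size t) p mw in
  r2.2 = wenc p' t' /\ r2.1.2 = eread t' p'.
Proof.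
move=> hp e m pend ws r1 r2 t' p'.
have -> : p' = umove p m by rewrite /p' do_move_eff.
have st : size t' = size t by rewrite size_write.
rewrite /r2 /r1 /ws /pend; case E: m => /=.
- have p0 : 0 < p.
    by move: E; rewrite /m /e; case: (p) => [|p1] //=; case: (mw).
  have -> : (e == inl true) = (p == (size t').+1).
    rewrite /e /eread st; case: p hp {p' E m pend ws r1 r2 t' st e} p0 => //= p hp _.
    case: ifP => h; last by rewrite eqxx; lia.
    by transitivity false; [|lia].
  rewrite wenc_fwd_stay // wenc_bwd_left /=; last by rewrite st p0.
  split=> //; rewrite /eread.
  case: p p0 hp {p' E m pend ws r1 r2 e} t' st => // -[|p] //= _ h t' st.
  by rewrite ifT // st; lia.
- rewrite wenc_fwd_stay // wenc_bwd_stay /=; split=> //.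
  by rewrite /e !ereadE st; case: (0 < p <= size t).
- have pS : p <= size t.
    move: E; rewrite /m /e ereadE; case: ifP => [|h] //=; first by lia.
    by have [->|] //= := eqVneq p 0; case: (mw).
  rewrite orbF; have [p0|p0] := posnP p.
    rewrite /e p0 /= wenc_fwd_enter /= wenc_bwd_stay //=; split=> //.
      by rewrite /t' p0.
    by rewrite /eread /= /t' p0.
  have -> : e == inl false = false by rewrite /e ereadE p0 pS.
  by rewrite /= wenc_fwd_right ?p0 //= wenc_bwd_stay.
Qed.

(** What one sweep out and back can do: a step of the virtual work tape, [V += X], [V -= 1] (adding
    the all-ones number), increments of [V], [X], [T] (as incoming carries), and finally
    [X := V; V := 0] on the way back. *)
Record cmd := Cmd { owb : bool; omw : move; oaddx : bool; odec : bool; oincv : bool;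
                    oincx : bool; oinct : bool; ocopy : bool }.

Section ColumnMachine.

Variables (Ctl : finType) (c0 : Ctl) (cout : Ctl -> option (option bool)).
(* The last three arguments: [V != 0], [X == V], [T != 0]. *)
Variable hm : Ctl -> option bool -> option bool -> hsym -> bool -> bool -> bool ->
  Ctl * cmd * bool * move * move.
Variables (k B : nat).

(** In [work_state]: the pending mark, the activity, mark and content bits of the column being
    crossed, and the scanned symbol. In [reg_state]: the three carries, one bit held over from a
    neighbouring track, and the three tests. *)
Definition work_state := (bool * bool * bool * bool * hsym)%type.
Definition reg_state := (bool * bool * bool * bool * bool * bool * bool)%type.
Definition sweep_op := (bool * move * bool * bool * bool)%type.
Definition sweep_state :=
  (Ctl * sweep_op * (bool * 'I_B.+1) * work_state * reg_state)%type.

Definition maj (a b c : bool) := (a && b) || (c && (a || b)).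

Definition gfwd (r : track) (g : sweep_state) (b : bool) : sweep_state * bool :=
  let: (ctl, o, (ini, j), (pend, ha, hm, hc, ws), (cx, cv, ct, hold, nzv, eq, nzt)) := g in
  let: (wb, mw, addx, dec, copy) := o in
  match r with
  | TA => let a := if ini then j < k else b in
      ((ctl, o, (ini, j), (pend, a, hm, hc, ws), (cx, cv, ct, hold, nzv, eq, nzt)), a)
  | TM => let rt := ha && (mw == mvR) in
      ((ctl, o, (ini, j), (if rt then b else pend, ha, ha && b, hc, ws),
        (cx, cv, ct, hold, nzv, eq, nzt)),
       if rt then (if b then false else pend) else b)
  | TC => (g, if hm then wb else b)
  | TX => ((ctl, o, (ini, j), (pend, ha, hm, hc, ws),
            (b && cx, cv, ct, b, nzv, eq, nzt)), b (+) cx)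
  | TV => let s := dec || (addx && hold) in
      ((ctl, o, (ini, j), (pend, ha, hm, hc, ws),
        (cx, maj b s cv, ct, hold, nzv, eq, nzt)), b (+) s (+) cv)
  | TT => ((ctl, o, (ini, j), (pend, ha, hm, hc, ws),
            (cx, cv, b && ct, hold, nzv, eq, nzt)), b (+) ct)
  | TE => ((ctl, o, (ini, ordS j), (pend, ha, hm, hc, ws),
            (cx, cv, ct, hold, nzv, eq, nzt)), ha)
  end.

Definition gbwd (r : track) (g : sweep_state) (b : bool) : sweep_state * bool :=
  let: (ctl, o, (ini, j), (pend, ha, hm, hc, ws), (cx, cv, ct, hold, nzv, eq, nzt)) := g in
  let: (wb, mw, addx, dec, copy) := o in
  match r with
  | TE => ((ctl, o, (ini, j), (pend, b, hm, hc, ws), (cx, cv, ct, hold, nzv, eq, nzt)), b)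
  | TT => ((ctl, o, (ini, j), (pend, ha, hm, hc, ws),
            (cx, cv, ct, hold, nzv, eq, b || nzt)), b)
  | TV => let v' := if copy then false else b in
      ((ctl, o, (ini, j), (pend, ha, hm, hc, ws),
        (cx, cv, ct, b, v' || nzv, eq, nzt)), v')
  | TX => let x' := if copy then hold else b in
      let v' := if copy then false else hold in
      ((ctl, o, (ini, j), (pend, ha, hm, hc, ws),
        (cx, cv, ct, hold, nzv, (x' == v') && eq, nzt)), x')
  | TC => ((ctl, o, (ini, j), (pend, ha, hm, b, ws), (cx, cv, ct, hold, nzv, eq, nzt)), b)
  | TM => let lf := ha && (mw == mvL) in
      let m' := if lf then (if b then false else pend) else b in
      ((ctl, o, (ini, j),
        (if lf then b else pend, ha, hm, hc, if ha && m' then inr hc else ws),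
        (cx, cv, ct, hold, nzv, eq, nzt)), m')
  | TA => (g, b)
  end.

(* [None] is the start state, whose first sweep marks [k] of every [B.+1]
   consecutive columns as active. *)
Definition ctl_state := option (track * sweep_state).

Definition colfwd (f : ctl_state) (b : bool) : ctl_state * bool :=
  if f is Some (r, g) then let: (g', b') := gfwd r g b in (Some (tnext r, g'), b')
  else (f, b).

Definition colbwd (f : ctl_state) (b : bool) : ctl_state * bool :=
  if f is Some (r, g) then
    let: (g', b') := gbwd (tprev r) g b in (Some (tprev r, g'), b')
  else (f, b).

(** The disjunction injects a pending mark when the virtual head leaves an end marker inwards. The
    [match] preloads the symbol that is correct if the way back meets no marked cell: the marker on
    the side of the move, or the old symbol for a stay. The last [true] is the neutral value of the
    conjunction that tests [X == V]. *)
Definition launch (ini : bool) (ctl : Ctl) (ws : hsym) (o : cmd) : ctl_state :=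
  let mw := eff ws (omw o) in
  Some (TA, (ctl, (owb o, mw, oaddx o, odec o, ocopy o), (ini, ord0),
    (((mw == mvR) && (ws == inl false)) || ((mw == mvL) && (ws == inl true)),
     false, false, false,
     match mw with mvL => inl false | mvS => ws | mvR => inl true end),
    (oincx o, oincv o, oinct o, false, false, true, false))).

Definition colhome (f : ctl_state) (i c : option bool) : ctl_state * bool * move * move :=
  if f is Some (_, (ctl, _, _, (_, _, _, _, ws), (_, _, _, _, nzv, eq, nzt))) then
    let: (ctl', o, cb, mi, mc) := hm ctl i c ws nzv eq nzt in
    (launch false ctl' ws o, cb, mi, mc)
  else
    (launch true c0 (inl false) (Cmd false mvS false false false false false false),
     odflt false c, mvS, mvS).

Definition colout (f : ctl_state) : option (option bool) :=
  if f is Some (_, (ctl, _, _, _, _)) then cout ctl else None.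

Definition column_TM : CatTM := sweepTM None colout colhome colfwd colbwd.

Definition cfwd (g : sweep_state) (c : col) : sweep_state * col :=
  let: (ctl, o, (ini, j), (pend, ha, hm, hc, ws), (cx, cv, ct, hold, nzv, eq, nzt)) := g in
  let: (wb, mw, addx, dec, copy) := o in
  let: Col a m ch x v t := c in
  let a' := if ini then j < k else a in
  let rt := a' && (mw == mvR) in
  let s := dec || (addx && x) in
  ((ctl, o, (ini, ordS j), (if rt then m else pend, a', a' && m, hc, ws),
    (x && cx, maj v s cv, t && ct, x, nzv, eq, nzt)),
   Col a' (if rt then (if m then false else pend) else m) (if a' && m then wb else ch)
     (x (+) cx) (v (+) s (+) cv) (t (+) ct)).

Definition cbwd (g : sweep_state) (c : col) : sweep_state * col :=
  let: (ctl, o, (ini, j), (pend, ha, hm, hc, ws), (cx, cv, ct, hold, nzv, eq, nzt)) := g in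
  let: (wb, mw, addx, dec, copy) := o in
  let: Col a m ch x v t := c in
  let lf := a && (mw == mvL) in
  let m' := if lf then (if m then false else pend) else m in
  let v' := if copy then false else v in
  let x' := if copy then v else x in
  ((ctl, o, (ini, j),
    (if lf then m else pend, a, hm, ch, if a && m' then inr ch else ws),
    (cx, cv, ct, v, v' || nzv, (x' == v') && eq, t || nzt)),
   Col a m' ch x' v' t).

Definition at_home (g : sweep_state) : ctl_state := Some (TA, g).

Lemma trl_bits g cols :
  trl colfwd (at_home g) (flatten (map bits cols)) =
  (at_home (trl cfwd g cols).1, flatten (map bits (trl cfwd g cols).2)).
Proof.
elim: cols g => // c cols IH g; rewrite [flatten _]/= -[_ :: _]/(bits c ++ _) trl_cat.
have -> : trl colfwd (at_home g) (bits c) = (at_home (cfwd g c).1, bits (cfwd g c).2).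
  case: g => [[[[ctl [[[[wb mw] addx] dec] copy]] [ini j]] [[[[pend ha] hm'] hc] ws]]
    [[[[[[cx cv] ct] hold] nzv] eq] nzt]]; by case: c => a m ch x v t.
by rewrite IH /=; case: (cfwd g c) => g' c' /=; case: trl.
Qed.

Lemma trr_bits g cols :
  trr colbwd (at_home g) (flatten (map bits cols)) =
  (at_home (trr cbwd g cols).1, flatten (map bits (trr cbwd g cols).2)).
Proof.
have E g1 c : trr colbwd (at_home g1) (bits c) = (at_home (cbwd g1 c).1, bits (cbwd g1 c).2).
  case: g1 => [[[[ctl [[[[wb mw] addx] dec] copy]] [ini j]] [[[[pend ha] hm'] hc] ws]]
    [[[[[[cx cv] ct] hold] nzv] eq] nzt]]; by case: c => a m ch x v t.
elim: cols => // c cols IH.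
rewrite -[flatten _]/(bits c ++ flatten (map bits cols)) trr_cat IH E [trr cbwd _ (_ :: _)]/=.
by case: (trr cbwd g cols) => {IH} g1 cols1; case: (cbwd g1 c).
Qed.

Lemma half_adder (a b : bool) : (a (+) b) + 2 * (a && b) = a + b.
Proof. by case: a; case: b. Qed.

Lemma full_adder (a b c : bool) : (a (+) b (+) c) + 2 * maj a b c = a + b + c.
Proof. by case: a; case: b; case: c. Qed.

Lemma carry_step a b c c' p q r :
  a + 2 * c' = b + c -> r + p = q + c' -> a + 2 * r + 2 * p = b + 2 * q + c.
Proof. lia. Qed.

(** Ripple-carry addition: the sweep meets the least significant digit first, and the final carry,
    weighted by [2 ^ size cols], is the overflow. With [dec] every digit of the addend is 1, whence
    [2 ^ size cols - 1]. *)
Lemma trl_cfwd ctl wb mw addx dec copy j pend ha hm' hc ws cx cv ct hold nzv eq nzt cols :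
  let r := trl cfwd (ctl, (wb, mw, addx, dec, copy), (false, j), (pend, ha, hm', hc, ws),
                     (cx, cv, ct, hold, nzv, eq, nzt)) cols in
  exists j' pend' ha' hm'' cx' cv' ct' hold',
  [/\ r.1 = (ctl, (wb, mw, addx, dec, copy), (false, j'), (pend', ha', hm'', hc, ws),
                     (cx', cv', ct', hold', nzv, eq, nzt)),
      (pend', wcells r.2) = trl (wfwd wb mw) pend (wcells cols),
      num kx r.2 + 2 ^ size cols * cx' = num kx cols + cx,
      num kv r.2 + 2 ^ size cols * cv' =
        num kv cols + (if dec then 2 ^ size cols - 1 else addx * num kx cols) + cv &
      num kt r.2 + 2 ^ size cols * ct' = num kt cols + ct].
Proof.
elim: cols j pend ha hm' cx cv ct hold => [|[a m ch x v t] cols IH] j pend ha hm' cx cv ct hold.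
  rewrite /=; exists j, pend, ha, hm', cx, cv, ct, hold.
  by split; rewrite ?muln0 ?if_same //= expn0 mul1n.
rewrite /=.
set pend1 := if a && (mw == mvR) then m else pend.
case: (trl cfwd _ cols) (IH (ordS j) pend1 a (a && m) (x && cx) (maj v (dec || addx && x) cv)
  (t && ct) x) => r1 r2 /=
  [j' [pend' [ha' [hm'' [cx' [cv' [ct' [hold' [-> E1 E2 E3 E4]]]]]]]]].
exists j', pend', ha', hm'', cx', cv', ct', hold'; split=> //.
- by rewrite /wcells /=; case: a @pend1 E1 => //=; rewrite /wcells => <-.
- by rewrite expnS -mulnA; apply: carry_step E2; apply: half_adder.
- rewrite expnS -mulnA.
  have -> : (if dec then 2 * 2 ^ size cols - 1 else addx * (x + 2 * num kx cols)) =
    (dec || addx && x) + 2 * (if dec then 2 ^ size cols - 1 else addx * num kx cols).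
    case: (dec) => /=; last by case: (addx); rewrite ?mul1n ?mul0n.
    by rewrite mulnBr addnBA // ?leq_pmulr ?expn_gt0 // addnC -subnBA.
  rewrite addnACA -mulnDr; apply: carry_step E3; apply: full_adder.
- by rewrite expnS -mulnA; apply: carry_step E4; apply: half_adder.
Qed.

(** The tests are gathered digit by digit from the values as they stand after [copy], so they are
    current when the head is home again. *)
Lemma trr_cbwd ctl wb mw addx dec copy ij pend ha hm' hc ws cx cv ct hold nzv eq nzt cols :
  let r := trr cbwd (ctl, (wb, mw, addx, dec, copy), ij, (pend, ha, hm', hc, ws),
                     (cx, cv, ct, hold, nzv, eq, nzt)) cols in
  exists pend' ha' hc' hold' ws',
  [/\ r.1 = (ctl, (wb, mw, addx, dec, copy), ij, (pend', ha', hm', hc', ws'),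
              (cx, cv, ct, hold', (num kv r.2 != 0) || nzv,
               (num kx r.2 == num kv r.2) && eq, (num kt r.2 != 0) || nzt)),
      ((pend', ws'), wcells r.2) = trr (wbwd mw) (pend, ws) (wcells cols),
      num kx r.2 = if copy then num kv cols else num kx cols,
      num kv r.2 = if copy then 0 else num kv cols &
      num kt r.2 = num kt cols].
Proof.
elim: cols => [|[a m ch x v t] cols [pend1 [ha1 [hc1 [hold1 [ws1]]]]]].
  by exists pend, ha, hc, hold, ws; split; rewrite ?if_same.
rewrite [trr cbwd _ (_ :: _)]/=; case: (trr cbwd _ cols) => r1 r2 [/= -> E1 E2 E3 E4].
case: ij => ini j.
exists (if a && (mw == mvL) then m else pend1), a, ch, v,
 (if a && (if a && (mw == mvL) then (if m then false else pend1) else m) then inr ch else ws1).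
split=> /=.
- congr (_, (_, _, _, _, _, _, _)).
  + by case: (copy); case: (v); case: (num kv r2).
  + case: (eq); rewrite ?andbF // !andbT.
    by case: (copy); case: (v); case: (x) => /=; apply/idP/idP => /eqP h; apply/eqP => //=; lia.
  + by case: (t); case: (num kt r2).
- rewrite /wcells /=; case: a => //=; rewrite -E1 /=.
  by case: (mw == mvL).
- by rewrite E2; case: (copy).
- by rewrite E3; case: (copy).
- by rewrite E4.
Qed.

(** * The abstract register machine realised by the columns *)

Variable l : nat.
Hypothesis k_le_B : k <= B.+1.

Record ast := Ast { actl : Ctl; aip : nat; acp : nat; act : seq bool;
                    awt : seq bool; awp : nat; ax : nat; av : nat; atm : nat }.

Definition modulus := 2 ^ (B.+1 * l).

Definition astep (x : seq bool) (a : ast) : ast :=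
  if cout (actl a) is Some _ then a else
  let: (ctl, o, cb, mi, mc) :=
    hm (actl a) (read x (aip a)) (read (act a) (acp a)) (eread (awt a) (awp a))
       (av a != 0) (ax a == av a) (atm a != 0) in
  let x1 := (ax a + oincx o) %% modulus in
  let v1 := (av a + (if odec o then modulus - 1 else oaddx o * ax a) + oincv o) %% modulus in
  Ast ctl (do_move (size x) (aip a) mi) (do_move (size (act a)) (acp a) mc)
    (write (act a) (acp a) cb) (write (awt a) (awp a) (owb o))
    (do_move (size (awt a)) (awp a) (omw o))
    (if ocopy o then v1 else x1) (if ocopy o then 0 else v1)
    ((atm a + oinct o) %% modulus).

(** At home the work tape is out of sight, so the invariant demands that the control already hold
    the scanned virtual symbol and the three register tests. *)
Definition represents (a : ast) (c : mcfg ctl_state) : Prop :=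
  exists cols o ini j pend ha hm' hc cx cv ct hold,
  [/\ mf c = at_home (actl a, o, (ini, j), (pend, ha, hm', hc, eread (awt a) (awp a)),
        (cx, cv, ct, hold, av a != 0, ax a == av a, atm a != 0)),
      [/\ mip c = aip a, mcp c = acp a, mct c = act a, mw c = flatten (map bits cols) &
          size cols = B.+1 * l],
      wcells cols = wenc (awp a) (awt a), awp a <= (size (awt a)).+1 &
      [/\ num kx cols = ax a, num kv cols = av a & num kt cols = atm a]].

Lemma modulus_step p q c : p < modulus -> p + modulus * c = q -> p = q %% modulus.
Proof. by move=> h <-; rewrite addnC mulnC modnMDl modn_small. Qed.

Lemma represents_step x a c : represents a c ->
  represents (astep x a) (mstep colout colhome colfwd colbwd x c).
Proof.
case=> cols [[[[[wb0 mw0] addx0] dec0] copy0]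
  [ini0 [j0 [pend0 [ha0 [hm0 [hc0 [cx0 [cv0 [ct0 [hold0]]]]]]]]]]].
case=> Ef [Eip Ecp Ect Ew Es] Ewc hwp [Ex Ev Et].
rewrite /astep /mstep Ef /=; case Eo: (cout _) => [o|].
  by exists cols, (wb0, mw0, addx0, dec0, copy0), ini0, j0, pend0, ha0, hm0, hc0,
    cx0, cv0, ct0, hold0.
rewrite Eip Ecp Ect; case: hm => [[[[ctl [wb mw addx dec incv incx inct copy]] cb] mi] mc].
rewrite /launch Ew trl_bits.
have := trl_cfwd ctl wb (eff (eread (awt a) (awp a)) mw) addx dec copy ord0
 (((eff (eread (awt a) (awp a)) mw == mvR) && (eread (awt a) (awp a) == inl false)) ||
  ((eff (eread (awt a) (awp a)) mw == mvL) && (eread (awt a) (awp a) == inl true)))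
 false false false
 (match eff (eread (awt a) (awp a)) mw with
  | mvL => inl false | mvS => eread (awt a) (awp a) | mvR => inl true end)
 incx incv inct false false true false cols.
set g := (ctl, _, _, _, _).
have s1 := size_trl cfwd g cols.
rewrite -[owb _]/wb -[omw _]/mw -[oaddx _]/addx -[odec _]/dec -[ocopy _]/copy
 -[oincx _]/incx -[oincv _]/incv -[oinct _]/inct -/g.
case: (trl cfwd g cols) s1 => g1 cols1 /= s1.
case=> j1 [pend1 [ha1 [hm1 [cx1 [cv1 [ct1 [hold1 [-> F1 F2 F3 F4]]]]]]]].
rewrite trr_bits.
set ws1 := match _ with mvL => _ | mvS => _ | mvR => _ end.
have := trr_cbwd ctl wb (eff (eread (awt a) (awp a)) mw) addx dec copy (false, j1) pend1 ha1 hm1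
  false ws1 cx1 cv1 ct1 hold1 false true false cols1.
set g2 := (ctl, _, _, _, _).
have s2 := size_trr cbwd g2 cols1.
case: (trr cbwd g2 cols1) s2 => g3 cols2 /= s2.
case=> pend2 [ha2 [hc2 [hold2 [ws2 [-> H1 H2 H3 H4]]]]].
have [W1 W2] := wenc_sweeps wb mw hwp.
rewrite -/ws1 -Ewc -F1 -H1 /= in W1 W2.
have m1 : num kx cols1 = (ax a + incx) %% modulus.
  apply: (@modulus_step _ _ cx1); first by rewrite /modulus -Es -s1 num_lt.
  by rewrite /modulus -Es F2 Ex.
have m2 : num kv cols1 = (av a + (if dec then modulus - 1 else addx * ax a) + incv) %% modulus.
  apply: (@modulus_step _ _ cv1); first by rewrite /modulus -Es -s1 num_lt.
  by rewrite /modulus -Es F3 Ex Ev.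
have m3 : num kt cols1 = (atm a + inct) %% modulus.
  apply: (@modulus_step _ _ ct1); first by rewrite /modulus -Es -s1 num_lt.
  by rewrite /modulus -Es F4 Et.
exists cols2; do 11 eexists; split=> /=.
- by rewrite W2 -m1 -m2 -m3 -H2 -H3 -H4 !orbF andbT.
- by split=> //; rewrite s2 s1.
- by rewrite W1.
- by rewrite size_write do_move_le.
- by rewrite H2 H3 H4 m1 m2 m3.
Qed.

Definition ini_col (i : nat) : col := Col (i %% B.+1 < k) false false false false false.

Lemma trl_ini ctl wb addx hc ws nzv eq nzt s n (j : 'I_B.+1) ha hm' hold : j = s %% B.+1 :> nat ->
  exists j' ha' hm'' hold',
  trl cfwd (ctl, (wb, mvS, addx, false, false), (true, j), (false, ha, hm', hc, ws),
            (false, false, false, hold, nzv, eq, nzt))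
    (nseq n (Col false false false false false false)) =
  ((ctl, (wb, mvS, addx, false, false), (true, j'), (false, ha', hm'', hc, ws),
            (false, false, false, hold', nzv, eq, nzt)), [seq ini_col i | i <- iota s n]).
Proof.
elim: n s j ha hm' hold => [|n IH] s j ha hm' hold hj /=; first by exists j, ha, hm', hold.
have hj' : ordS j = s.+1 %% B.+1 :> nat by rewrite /= hj -addn1 modnDml addn1.
rewrite !andbF /maj /= hj.
have [j' [ha' [hm'' [hold' ->]]]] := IH s.+1 (ordS j) (s %% B.+1 < k) false false hj'.
by exists j', ha', hm'', hold'.
Qed.

Lemma wcells_ini s n :
  wcells [seq ini_col i | i <- iota s n] =
  nseq (count (fun i => i %% B.+1 < k) (iota s n)) (false, false).
Proof. by elim: n s => //= n IH s; rewrite /wcells /=; case: ifP => //= _; rewrite -IH. Qed.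

(** This is exactly the work space that [M] expects. Selecting columns by their residue produces it
    in one sweep, without [l] being known to the control. *)
Lemma count_active : count (fun i => i %% B.+1 < k) (iota 0 (B.+1 * l)) = k * l.
Proof.
elim: l => [|m IH]; first by rewrite !muln0.
rewrite !mulnS addnC iotaD count_cat IH addnC add0n; congr (_ + _).
rewrite -[X in iota X]addn0 iotaDl count_map.
rewrite (@eq_in_count _ _ (fun i => i < k)).
  elim: (B.+1) k k_le_B => [|b IHb] k' hk; first by move: hk; rewrite leqn0 => /eqP->.
  rewrite -addn1 iotaD count_cat /= addn0.
  have [hb|hb] := ltnP b k'.
    have -> : k' = b.+1 by lia.
    rewrite (@eq_in_count _ _ (fun i => i < b)); first by rewrite IHb // addn1.
    by move=> i; rewrite mem_iota => h; lia.
  by rewrite IHb // addn0.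
move=> i; rewrite mem_iota => h /=.
by rewrite mulnC modnMDl modn_small.
Qed.

Lemma num_ini f s n : (forall i, f (ini_col i) = false) ->
  num f [seq ini_col i | i <- iota s n] = 0.
Proof. by move=> hf; elim: n s => //= n IH s; rewrite IH hf. Qed.

Lemma wenc0_nseq n : wenc 0 (nseq n false) = nseq n (false, false).
Proof. by elim: n => //= n ->. Qed.

Definition ast0 (tau : seq bool) : ast := Ast c0 0 0 tau (nseq (k * l) false) 0 0 0 0.

Lemma represents_init x tau :
  represents (ast0 tau)
    (mstep colout colhome colfwd colbwd x
       (@MCfg ctl_state None 0 0 (nseq (7 * (B.+1 * l)) false) tau)).
Proof.
have E : nseq (7 * (B.+1 * l)) false =
  flatten (map bits (nseq (B.+1 * l) (Col false false false false false false))).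
  by elim: (B.+1 * l) => // n IH; rewrite mulnS nseqD IH.
rewrite /mstep E [colhome _ _ _]/= /launch trl_bits.
have [j1 [ha1 [hm1 [hold1 E1]]]] := @trl_ini c0 false false false (inl false) false true false 0
  (B.+1 * l) ord0 false false false erefl.
rewrite [trl _ _ _]E1 trr_bits /=.
set g2 := (c0, _, _, _, _); set cols1 := [seq _ | _ <- _].
have s2 := size_trr cbwd g2 cols1.
have := trr_cbwd c0 false mvS false false false (true, j1) false ha1 hm1
  false (inl false) false false false hold1 false true false cols1.
rewrite -/g2.
case: (trr cbwd g2 cols1) s2 => g3 cols2 /= s2.
case=> pend2 [ha2 [hc2 [hold2 [ws2 [-> H1 H2 H3 H4]]]]].
rewrite wcells_ini count_active -wenc0_nseq wenc0_bwd in H1.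
case: H1 => _ Ews Ewc.
have E2 : num kx cols2 = 0 by rewrite H2 num_ini.
have E3 : num kv cols2 = 0 by rewrite H3 num_ini.
have E4 : num kt cols2 = 0 by rewrite H4 num_ini.
exists cols2; do 11 eexists; split=> //=.
- by rewrite E2 E3 E4 Ews /=.
- by split=> //; rewrite ?write_read // s2 size_map size_iota.
Qed.

(** The additional macro step in [t.+1] is the initial sweep that marks the active columns. *)
Lemma column_TM_run x tau t :
  let s := 7 * (B.+1 * l) in
  let a := iter t (astep x) (ast0 tau) in
  let c := run column_TM x s tau (t.+1 * (2 * s + 3)) in
  (halt_out column_TM (cst c) = cout (actl a)) /\ ctape c = act a.
Proof.
move=> s a c.
set m0 := @MCfg ctl_state None 0 0 (nseq s false) tau.
have -> : c = of_mcfg None colout colhome colfwd colbwd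
                (iter t.+1 (mstep colout colhome colfwd colbwd x) m0).
  by rewrite -sweepTM_iter /= size_nseq.
have : represents a (iter t.+1 (mstep colout colhome colfwd colbwd x) m0).
  rewrite /a; elim: (t) => [|t1 IH]; first exact: represents_init.
  by rewrite iterS; apply: represents_step.
case: (iter t.+1 _ _) => f ip cp w ct.
case=> cols [o [ini [j [pend [ha [hm' [hc [cx [cv [ct' [hold]]]]]]]]]]].
by case=> /= -> [_ _ -> _ _].
Qed.

End ColumnMachine.

(** * The Euler tour of the configuration graph *)

Definition bitof (e : hsym) : bool := if e is inr b then b else false.
Definition setb (e : hsym) (b : bool) : hsym := if e is inr _ then inr b else e.
Definition opp_move (m : move) : move :=
  match m with mvL => mvR | mvS => mvS | mvR => mvL end.

Lemma opp_moveK : involutive opp_move. Proof. by case. Qed.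

Lemma eff_setb e b m : eff (setb e b) m = eff e m. Proof. by case: e. Qed.
Lemma eff_eff e m : eff e (eff e m) = eff e m. Proof. by case: e => [[]|b]; case: m. Qed.
Lemma setb_setb e b b' : setb (setb e b) b' = setb e b'. Proof. by case: e. Qed.
Lemma setb_bitof e : setb e (bitof e) = e. Proof. by case: e. Qed.

Lemma write_bitof t p : write t p (bitof (eread t p)) = t.
Proof.
rewrite -[RHS](write_read t p) -forget_eread.
by case: eread.
Qed.

Lemma eread_write t p b : eread (write t p b) p = setb (eread t p) b.
Proof.
rewrite !ereadE size_write /write; case: (0 < p <= size t) => //=.
by rewrite nth_set_nth /= eqxx.
Qed.

Lemma write_write t p b b' : write (write t p b) p b' = write t p b'.
Proof.
rewrite {1}/write size_write /write; case: (0 < p <= size t) => //.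
by rewrite set_set_nth eqxx.
Qed.

Lemma write_setb_aux t p b : write t p b = write t p (bitof (setb (eread t p) b)).
Proof. by rewrite ereadE /write; case: (0 < p <= size t). Qed.

Lemma write_setb t p b : setb (eread t p) b = eread t p -> write t p b = t.
Proof.
by move=> h; rewrite -[RHS](write_bitof t p) -h -write_setb_aux.
Qed.

Lemma effL t p : eff (eread t p) mvL = mvL <-> 0 < p.
Proof. by rewrite /eread; case: p => //= p; case: ifP. Qed.

Lemma effR t p : eff (eread t p) mvR = mvR <-> p <= size t.
Proof. by rewrite /eread; case: p => //= p; case: ifP. Qed.

(** Whether a move is blocked depends on the length of the tape alone, so the inverse move stays
    effective after the scanned cell has been overwritten. *)
Lemma do_move_opp t t' p m : size t' = size t -> p <= (size t).+1 -> eff (eread t p) m = m ->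
  let p' := do_move (size t) p m in
  [/\ eff (eread t' p') (opp_move m) = opp_move m, do_move (size t) p' (opp_move m) = p &
      p' <= (size t).+1].
Proof.
move=> st hp; case: m => //=.
- rewrite effL => p0; split; [rewrite effR st; lia|lia|lia].
- by split=> //; case: eread => [[]|].
- rewrite effR => ps; split; [rewrite effL; lia|lia|lia].
Qed.

Lemma do_move_eff_eq t p n m : p <= (size t).+1 -> eff (eread t p) n = m ->
  do_move (size t) p n = do_move (size t) p m.
Proof. by move=> hp <-; rewrite !do_move_eff // eff_eff. Qed.

Section Tour.

Variables (M : CatTM) (x : seq bool).

(* A label is what it takes to undo a step: the old state, the inverse head moves and
   the overwritten bits.  A dart [(v, None)] is the edge from [v] to its successor, seen
   from [v]; [(v, Some e)] is the possible edge into [v] from the predecessor given by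
   the label [e].  [theta] passes to the other end of the edge, if there is one, in two
   rounds because the candidate predecessor's cells must be read before it is checked. *)
Definition label := (st M * move * move * move * bool * bool)%type.
Definition slot := option label.
Definition vaction := (st M * bool * bool * move * move * move)%type.
Definition dart := (config (st M) * slot)%type.

Definition vact (v : config (st M)) (a : vaction) : config (st M) :=
  let: (q, wb, cb, mi, mw, mc) := a in
  Config q (do_move (size x) (ipos v) mi) (do_move (size (wtape v)) (wpos v) mw)
    (do_move (size (ctape v)) (cpos v) mc) (write (wtape v) (wpos v) wb)
    (write (ctape v) (cpos v) cb).

Arguments vact : simpl never.

Definition null_action (q : st M) (ew ec : hsym) : vaction :=
  (q, bitof ew, bitof ec, mvS, mvS, mvS).

(** A label whose moves would bump into a marker cannot come from a step and is rejected before
    anything moves; the remaining moves can be taken back. *)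
Definition legal (ei ew ec : hsym) (mi mw mc : move) : bool :=
  [&& eff ei mi == mi, eff ew mw == mw & eff ec mc == mc].

(** The boolean requests the second round: it is set only when the heads have moved along a label
    whose candidate predecessor is still unchecked. *)
Definition decA (s : slot) (q : st M) (ei ew ec : hsym) : slot * bool * vaction :=
  match s with
  | None =>
    if halt_out M q is Some _ then (None, false, null_action q ew ec) else
    let a := trans M q (forget ei) (forget ew) (forget ec) in
    let: (_, _, _, mi, mw, mc) := a in
    (Some (q, opp_move (eff ei mi), opp_move (eff ew mw), opp_move (eff ec mc),
           bitof ew, bitof ec), false, a)
  | Some (_, mi, mw, mc, _, _) =>
    if legal ei ew ec mi mw mc then (s, true, (q, bitof ew, bitof ec, mi, mw, mc))
    else (s, false, null_action q ew ec)
  end.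

(* After the heads have been moved along a label: is the configuration with the
   label's state and bits a predecessor, with exactly this label? *)
Definition chk (q : st M) (e : label) (ei ew ec : hsym) : bool :=
  let: (q0, mi, mw, mc, wb, cb) := e in
  let: (q', wb', cb', ni, nw, nc) :=
    trans M q0 (forget ei) (forget (setb ew wb)) (forget (setb ec cb)) in
  [&& halt_out M q0 == None, q' == q,
      [&& bitof (setb ew wb) == wb, bitof (setb ec cb) == cb, setb ew wb' == ew &
          setb ec cb' == ec] &
      [&& eff ei ni == opp_move mi, eff ew nw == opp_move mw & eff ec nc == opp_move mc]].

Definition decB (s : slot) (mode : bool) (q : st M) (ei ew ec : hsym) : slot * vaction :=
  if mode then
    if s is Some e then
      let: (q0, mi, mw, mc, wb, cb) := e in
      if chk q e ei ew ec then (None, (q0, wb, cb, mvS, mvS, mvS))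
      else (s, (q, bitof ew, bitof ec, opp_move mi, opp_move mw, opp_move mc))
    else (s, null_action q ew ec)
  else (s, null_action q ew ec).

Definition esi (v : config (st M)) := eread x (ipos v).
Definition esw (v : config (st M)) := eread (wtape v) (wpos v).
Definition esc (v : config (st M)) := eread (ctape v) (cpos v).

Definition thetaA (d : dart) : dart * bool :=
  let: (s, mode, a) := decA d.2 (cst d.1) (esi d.1) (esw d.1) (esc d.1) in
  ((vact d.1 a, s), mode).
Arguments decB : simpl never.

Definition thetaB (dm : dart * bool) : dart :=
  let: (d, mode) := dm in
  let: (s, a) := decB d.2 mode (cst d.1) (esi d.1) (esw d.1) (esc d.1) in
  (vact d.1 a, s).
Definition theta (d : dart) : dart := thetaB (thetaA d).

Definition wf (v : config (st M)) : Prop :=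
  [/\ ipos v <= (size x).+1, wpos v <= (size (wtape v)).+1 & cpos v <= (size (ctape v)).+1].

Definition lab (v : config (st M)) : label :=
  let: (_, _, _, mi, mw, mc) :=
    trans M (cst v) (forget (esi v)) (forget (esw v)) (forget (esc v)) in
  (cst v, opp_move (eff (esi v) mi), opp_move (eff (esw v) mw), opp_move (eff (esc v) mc),
   bitof (esw v), bitof (esc v)).

Lemma wf_vact v a : wf v -> wf (vact v a).
Proof.
case: a => [[[[[q wb] cb] mi] mw] mc] [h1 h2 h3].
by rewrite /wf /vact /= !size_write; split; apply: do_move_le.
Qed.

Lemma vact_null v : vact v (null_action (cst v) (esw v) (esc v)) = v.
Proof. by rewrite /vact /= !write_bitof; case: v. Qed.

Lemma step_vact v : halt_out M (cst v) = None ->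
  step M x v = vact v (trans M (cst v) (forget (esi v)) (forget (esw v)) (forget (esc v))).
Proof. by rewrite /step !forget_eread => ->; case: trans => [[[[[q wb] cb] mi] mw] mc]. Qed.

Lemma thetaB_done v s : thetaB (v, s, false) = (v, s).
Proof. by rewrite -[in RHS](vact_null v). Qed.

Lemma theta_halt v : halt_out M (cst v) <> None -> theta (v, None) = (v, None).
Proof.
rewrite /theta /thetaA /decA [fst _]/= [snd _]/=; case: (halt_out _ _) => // o _.
by rewrite thetaB_done vact_null.
Qed.

Lemma theta_up v : halt_out M (cst v) = None ->
  theta (v, None) = (step M x v, Some (lab v)).
Proof.
move=> E; rewrite /theta /thetaA /decA [fst _]/= [snd _]/= E step_vact // /lab.
by case: trans => [[[[[q wb] cb] mi] mw] mc]; rewrite thetaB_done.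
Qed.

(** A downward dart is followed by guessing: the heads move as the label says, then [chk] compares
    the effect of a step from the restored cells with the configuration at hand. Legal moves are
    invertible, so after a failed check they are undone and the dart is a fixed point. *)
Lemma theta_down v e : wf v ->
  theta (v, Some e) = (v, Some e) \/
  exists u, [/\ theta (v, Some e) = (u, None), wf u, halt_out M (cst u) = None,
                step M x u = v & lab u = e].
Proof.
move=> hwf; case: (hwf) => h1 h2 h3.
case: e => [[[[[q0 mi] mw] mc] wb] cb].
rewrite /theta /thetaA /decA [fst _]/= [snd _]/=.
case: ifP => [/and3P[/eqP li /eqP lw /eqP lc]|_]; last first.
  by left; rewrite thetaB_done vact_null.
set v1 := vact _ _.
have Ev1 : v1 = Config (cst v) (do_move (size x) (ipos v) mi) (do_move (size (wtape v)) (wpos v) mw)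
    (do_move (size (ctape v)) (cpos v) mc) (wtape v) (ctape v).
  by rewrite /v1 /vact /= !write_bitof.
have wf1 : wf v1 by apply: wf_vact.
have [i1 i2 i3] := do_move_opp (erefl (size x)) h1 li.
have [w1 w2 w3] := do_move_opp (erefl (size (wtape v))) h2 lw.
have [c1 c2 c3] := do_move_opp (erefl (size (ctape v))) h3 lc.
rewrite /thetaB /decB [fst _]/= [snd _]/= (_ : cst v1 = cst v); last by rewrite Ev1.
case: ifP => [hc|_]; last first.
  left; rewrite /vact !Ev1 /= i2 w2 c2; congr (_, _).
  by rewrite /esw /esc /= !write_bitof; case: (v).
right; set u := vact v1 _; exists u.
have Eu : u = Config q0 (ipos v1) (wpos v1) (cpos v1) (write (wtape v) (wpos v1) wb)
   (write (ctape v) (cpos v1) cb) by rewrite /u Ev1 /vact.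
have ei : esi u = esi v1 by rewrite Eu.
have wt1 : wtape v1 = wtape v by rewrite Ev1.
have ct1 : ctape v1 = ctape v by rewrite Ev1.
have ew : esw u = setb (esw v1) wb by rewrite Eu /esw wt1 -eread_write.
have ec : esc u = setb (esc v1) cb by rewrite Eu /esc ct1 -eread_write.
have wfu : wf u by apply: wf_vact.
move: hc; rewrite /chk -ei -ew -ec.
case Et: (trans M q0 (forget (esi u)) (forget (esw u)) (forget (esc u))) =>
  [[[[[q' wb'] cb'] ni] nw] nc].
case/and4P=> /eqP hh /eqP Eq /and4P[/eqP b1 /eqP b2 /eqP b3 /eqP b4]
  /and3P[/eqP e1 /eqP e2 /eqP e3].
have hu : halt_out M (cst u) = None by rewrite Eu.
have [u1 u2 u3] := wfu.
have e2' : eff (esw u) nw = opp_move mw by rewrite ew eff_setb.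
have e3' : eff (esc u) nc = opp_move mc by rewrite ec eff_setb.
split=> //.
  rewrite step_vact // (_ : cst u = q0); last by rewrite Eu.
  rewrite Et /vact (do_move_eff_eq u1 e1) (do_move_eff_eq u2 e2').
  rewrite (do_move_eff_eq u3 e3').
  rewrite Eu Ev1 /= !size_write i2 w2 c2 Eq !write_write.
  rewrite !write_setb; first by case: (v).
    by move: b4; rewrite /esc Ev1.
  by move: b3; rewrite /esw Ev1.
(* On an end marker [bitof] is [false]; [b1] and [b2] exclude any other label bit there, which would
   give the same predecessor a second slot. *)
rewrite /lab (_ : cst u = q0); last by rewrite Eu.
by rewrite Et e1 e2' e3' !opp_moveK b1 b2.
Qed.

Lemma theta_back u : wf u -> halt_out M (cst u) = None ->
  theta (step M x u, Some (lab u)) = (u, None).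
Proof.
move=> hwf hu; case: (hwf) => h1 h2 h3.
have hv := step_vact hu; set v := step M x u in hv *.
rewrite /lab; case Et: (trans M _ _ _ _) hv => [[[[[q' wb'] cb'] ni] nw] nc] hv.
set mi := opp_move (eff (esi u) ni); set mw := opp_move (eff (esw u) nw).
set mc := opp_move (eff (esc u) nc).
have sw : size (wtape v) = size (wtape u) by rewrite hv /vact /= size_write.
have sc : size (ctape v) = size (ctape u) by rewrite hv /vact /= size_write.
have [i1 i2 i3] := do_move_opp (erefl (size x)) h1 (eff_eff (esi u) ni).
have [w1 w2 w3] := do_move_opp sw h2 (eff_eff (esw u) nw).
have [c1 c2 c3] := do_move_opp sc h3 (eff_eff (esc u) nc).
have pi : ipos v = do_move (size x) (ipos u) (eff (esi u) ni).
  by rewrite hv /vact /=; apply: do_move_eff_eq.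
have pw : wpos v = do_move (size (wtape u)) (wpos u) (eff (esw u) nw).
  by rewrite hv /vact /=; apply: do_move_eff_eq.
have pc : cpos v = do_move (size (ctape u)) (cpos u) (eff (esc u) nc).
  by rewrite hv /vact /=; apply: do_move_eff_eq.
rewrite -pi in i1 i2; rewrite -pw in w1 w2; rewrite -pc in c1 c2.
rewrite /theta /thetaA /decA [fst _]/= [snd _]/= /legal.
rewrite i1 w1 c1 !eqxx /=.
set v1 := vact _ _.
have Ev1 : v1 = Config q' (ipos u) (wpos u) (cpos u) (write (wtape u) (wpos u) wb')
    (write (ctape u) (cpos u) cb').
  by rewrite /v1 /vact /= !write_bitof sw sc i2 w2 c2 hv /vact.
have ei : esi v1 = esi u by rewrite Ev1.
have ew : esw v1 = setb (esw u) wb' by rewrite Ev1 /esw -eread_write.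
have ec : esc v1 = setb (esc u) cb' by rewrite Ev1 /esc -eread_write.
rewrite /= /decB /chk ei ew ec !setb_setb !setb_bitof Et hu.
have -> : cst v = q' by rewrite hv.
rewrite !eff_setb !opp_moveK !setb_setb !eqxx /= Ev1 /vact /=.
by rewrite !write_write !write_bitof; case: (u).
Qed.

(** * Rotation of slots and the reversible tour *)

Definition nxt (s : slot) : slot := next (enum {: slot}) s.
Definition prv (s : slot) : slot := prev (enum {: slot}) s.

Lemma nxtK : cancel nxt prv. Proof. by move=> s; rewrite /nxt /prv prev_next // enum_uniq. Qed.

Lemma iter_nxt s s' : exists j, iter j nxt s = s'.
Proof.
have hc : fcycle nxt (enum {: slot}) by apply: cycle_next; apply: enum_uniq.
have : fconnect nxt s s' by rewrite (fconnect_cycle hc) ?mem_enum.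
by move=> h; exists (findex nxt s s'); apply: iter_findex.
Qed.

(** A combinatorial map: the edge involution [theta] followed by the rotation [nxt] at a vertex,
    which on a tree traces the Euler tour. Slots without an edge are fixed by [theta] and merely
    skipped. Both factors are invertible, hence [untour]. *)
Definition tour (d : dart) : dart := let d' := theta d in (d'.1, nxt d'.2).
Definition untour (d : dart) : dart := theta (d.1, prv d.2).

Lemma wf_theta d : wf d.1 -> wf (theta d).1.
Proof.
rewrite /theta /thetaB /thetaA => h.
case: decA => [[s m] a] /=; case: decB => [s' a'].
by do 2 apply: wf_vact.
Qed.

Lemma thetaK d : wf d.1 -> theta (theta d) = d.
Proof.
case: d => v [e|] /= h.
  case: (theta_down e h) => [E|[u [-> wfu hu <- <-]]]; first by rewrite !E.
  exact: theta_up.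
case E: (halt_out M (cst v)) => [o|].
  by rewrite !theta_halt // E.
by rewrite theta_up // theta_back.
Qed.

Lemma tourK d : wf d.1 -> untour (tour d) = d.
Proof. by move=> h; rewrite /untour /= nxtK -surjective_pairing thetaK. Qed.

Lemma wf_tour d : wf d.1 -> wf (tour d).1. Proof. exact: wf_theta. Qed.

Lemma wf_iter_tour i d : wf d.1 -> wf (iter i tour d).1.
Proof. by move=> h; elim: i => //= i; apply: wf_tour. Qed.

Lemma iter_tourK i d : wf d.1 -> iter i untour (iter i tour d) = d.
Proof.
by move=> h; elim: i => // i IH; rewrite iterSr iterS tourK //; apply: wf_iter_tour.
Qed.

Lemma iter_tour_inj i d d' : wf d.1 -> wf d'.1 -> iter i tour d = iter i tour d' -> d = d'.
Proof. by move=> h h' E; rewrite -(iter_tourK i h) E iter_tourK. Qed.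

Definition ends (v : config (st M)) (o : option bool) (tau : seq bool) : Prop :=
  exists t, halt_out M (cst (iter t (step M x) v)) = Some o /\
            ctape (iter t (step M x) v) = tau.

Lemma step_halt v : halt_out M (cst v) <> None -> step M x v = v.
Proof. by rewrite /step; case: halt_out. Qed.

Lemma iter_step_halt v t : halt_out M (cst v) <> None -> iter t (step M x) v = v.
Proof. by move=> h; elim: t => //= t ->; apply: step_halt. Qed.

Lemma ends_fun v o o' tau tau' : ends v o tau -> ends v o' tau' -> o = o' /\ tau = tau'.
Proof.
move=> [t [h1 h2]] [t' [h1' h2']].
wlog le : t t' o o' tau tau' h1 h2 h1' h2' / t <= t'.
  by move=> H; case/orP: (leq_total t t') => /H; [apply|case/(_ _ _ _ _ h1' h2' h1 h2)].
move: h1' h2'; rewrite -(subnK le) iterD iter_step_halt; last by rewrite h1.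
by rewrite h1 h2 => -[->].
Qed.

Lemma ends_step v o tau : ends (step M x v) o tau <-> ends v o tau.
Proof.
split=> [[t h]|[t [h1 h2]]]; first by exists t.+1; rewrite iterSr.
exists t; rewrite -iterSr iterS step_halt //; by rewrite h1.
Qed.

(** [theta] travels only along edges of [step], in either direction. Output and final tape are thus
    constant along a tour, which keeps the orbits of different contents apart and makes any halting
    configuration met on the way trustworthy. *)
Lemma ends_theta d o tau : wf d.1 -> ends (theta d).1 o tau <-> ends d.1 o tau.
Proof.
case: d => v [e|] /= h.
  by case: (theta_down e h) => [-> //|[u [-> wfu hu <- _]]] /=; rewrite ends_step.
case E: (halt_out M (cst v)) => [o'|]; first by rewrite theta_halt // E.
by rewrite theta_up //= ends_step.
Qed.

Lemma ends_iter_tour i d o tau : wf d.1 -> ends (iter i tour d).1 o tau <-> ends d.1 o tau.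
Proof.
move=> h; elim: i => // i IH; rewrite iterS -IH.
by rewrite -(ends_theta _ _ (wf_iter_tour i h)).
Qed.


(** * Finiteness: the tour reaches the root, and slow orbits are few *)

Variables (sw sc : nat).

Definition wfs (v : config (st M)) : Prop :=
  [/\ wf v, size (wtape v) = sw & size (ctape v) = sc].

Lemma wfs_vact v a : wfs v -> wfs (vact v a).
Proof.
move=> [h1 h2 h3]; split; first exact: wf_vact.
  by case: a => [[[[[q wb] cb] mi] mw] mc]; rewrite /= size_write.
by case: a => [[[[[q wb] cb] mi] mw] mc]; rewrite /= size_write.
Qed.

Lemma wfs_step v : wfs v -> wfs (step M x v).
Proof.
move=> h; case E: (halt_out M (cst v)) => [o|]; first by rewrite /step E.
by rewrite step_vact //; apply: wfs_vact.
Qed.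

Lemma wfs_iter_step v t : wfs v -> wfs (iter t (step M x) v).
Proof. by move=> h; elim: t => //= t; apply: wfs_step. Qed.

Lemma wfs_tour d : wfs d.1 -> wfs (tour d).1.
Proof.
rewrite /tour /theta /thetaB /thetaA => h.
case: decA => [[s m] a] /=; case: decB => [s' a'].
by do 2 apply: wfs_vact.
Qed.

Lemma wfs_iter_tour i d : wfs d.1 -> wfs (iter i tour d).1.
Proof. by move=> h; elim: i => //= i; apply: wfs_tour. Qed.

Definition code_type :=
  (st M * 'I_(size x).+2 * 'I_sw.+2 * 'I_sc.+2 * {ffun 'I_sw -> bool} * {ffun 'I_sc -> bool})%type.

Definition code (v : config (st M)) : code_type :=
  (cst v, inord (ipos v), inord (wpos v), inord (cpos v),
   [ffun i : 'I_sw => nth false (wtape v) i], [ffun i : 'I_sc => nth false (ctape v) i]).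

Lemma code_inj v v' : wfs v -> wfs v' -> code v = code v' -> v = v'.
Proof.
have nth_eq n (t t' : seq bool) : size t = n -> size t' = n ->
    [ffun i : 'I_n => nth false t i] = [ffun i : 'I_n => nth false t' i] -> t = t'.
  move=> st st' /ffunP h; apply: (@eq_from_nth _ false) => [|i]; first by rewrite st.
  by rewrite st => hi; move: (h (Ordinal hi)); rewrite !ffunE.
have inord_eq n i j : i < n.+2 -> j < n.+2 -> @inord n.+1 i = inord j -> i = j.
  by move=> hi hj /(congr1 val); rewrite /= !inordK.
case: v => q ip wp cp wt ct; case: v' => q' ip' wp' cp' wt' ct'.
move=> [[/= h1 h2 h3] h4 h5] [[/= k1 k2 k3] k4 k5] [-> E1 E2 E3 E4 E5].
rewrite h4 h5 k4 k5 in h2 h3 k2 k3.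
rewrite (inord_eq _ _ _ h1 k1 E1) (inord_eq _ _ _ h2 k2 E2) (inord_eq _ _ _ h3 k3 E3).
by rewrite (nth_eq _ _ _ h4 k4 E4) (nth_eq _ _ _ h5 k5 E5).
Qed.

Definition halted_cfg (v : config (st M)) : bool := halt_out M (cst v) != None.

Definition exact_depth (t : nat) (v : config (st M)) : Prop :=
  halted_cfg (iter t (step M x) v) /\
  forall i, i < t -> ~~ halted_cfg (iter i (step M x) v).

(** A configuration repeated among times [0] to [t] would allow a shortcut to a halting
    configuration before time [t]. *)
Lemma exact_depth_lt t v : wfs v -> exact_depth t v -> t < #|{: code_type}|.
Proof.
move=> hv [h1 h2]; rewrite -(card_ord t.+1).
pose f (i : 'I_t.+1) := code (iter i (step M x) v).
suff inj_f : injective f by rewrite -(card_codom inj_f) max_card.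
move=> i j /code_inj E; have {}E := E (wfs_iter_step _ hv) (wfs_iter_step _ hv).
apply: val_inj => /=; apply/eqP; case: ltngtP => // lt; exfalso.
  have : ~~ halted_cfg (iter ((t - j) + i) (step M x) v) by apply: h2; have := ltn_ord j; lia.
  by rewrite iterD E -iterD subnK ?h1 // -ltnS.
have : ~~ halted_cfg (iter ((t - i) + j) (step M x) v) by apply: h2; have := ltn_ord i; lia.
by rewrite iterD -E -iterD subnK ?h1 // -ltnS.
Qed.

Lemma ends_exact_depth v o tau : ends v o tau -> exists t, exact_depth t v.
Proof.
move=> [t [h _]].
have ex : exists t, halted_cfg (iter t (step M x) v) by exists t; rewrite /halted_cfg h.
exists (ex_minn ex); case: ex_minnP => m hm hmin; split=> // i hi.
by apply/negP => /hmin; rewrite leqNgt hi.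
Qed.

Definition reach (d d' : dart) : Prop := exists i, iter i tour d = d'.

Lemma reach_refl d : reach d d. Proof. by exists 0. Qed.
Lemma reach_trans d1 d2 d3 : reach d1 d2 -> reach d2 d3 -> reach d1 d3.
Proof. by move=> [i <-] [j <-]; exists (j + i); rewrite iterD. Qed.
Lemma reach_tour d d' : reach (tour d) d' -> reach d d'.
Proof. by move=> [i <-]; exists i.+1; rewrite iterSr. Qed.

(* The tour visits the whole subtree below [v] before it leaves through the parent
   edge; the induction is on the height left above the deepest possible vertex. *)
Lemma reach_parent_slot v t s : wfs v -> exact_depth t v -> reach (v, s) (v, None).
Proof.
have [m] := ubnP (#|{: code_type}| - t); elim: m v t s => // m IH v t s hm hv ht.
have next_slot e : reach (v, Some e) (v, nxt (Some e)).
  have [hwf _ _] := hv.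
  case: (theta_down e hwf) => [E|[u [E wfu hu Eu El]]].
    by exists 1; rewrite /= /tour E.
  apply: reach_tour; rewrite /tour E /=.
  apply: (@reach_trans _ (u, None)); last first.
    by exists 1; rewrite /= /tour theta_up // Eu El.
  have su : wfs u.
    have : wfs (tour (v, Some e)).1 by apply: wfs_tour.
    by rewrite /tour E.
  have du : exact_depth t.+1 u.
    case: ht => h1 h2; split=> [|[|i] hi]; rewrite ?iterSr ?Eu //; last exact: h2.
    by rewrite /halted_cfg /= hu.
  apply: (IH _ t.+1) => //.
  have := exact_depth_lt hv ht; have := exact_depth_lt su du; lia.
have [j] := iter_nxt s None; elim: j s => [|j IHj] s; first by move=> /= ->; apply: reach_refl.
case: s => [e|_]; last exact: reach_refl.
by rewrite iterSr => /IHj; apply: reach_trans.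
Qed.

(** From the parent slot the tour passes to the successor, and [reach_parent_slot] then brings it to
    the parent slot there, one level nearer to the root. *)
Lemma reach_halted v o tau : wfs v -> ends v o tau ->
  exists i, halted_cfg (iter i tour (v, None)).1.
Proof.
move=> hv /ends_exact_depth [t]; elim: t v hv => [|t IH] v hv ht.
  by exists 0; case: ht.
have hu : halt_out M (cst v) = None.
  by case: ht => _ /(_ 0 isT); rewrite negbK => /eqP.
have ht' : exact_depth t (step M x v).
  case: ht => h1 h2; split=> [|i hi]; first by rewrite -iterSr.
  by rewrite -iterSr; apply: h2.
have [i hi] := IH _ (wfs_step hv) ht'.
have [j hj] := reach_parent_slot (nxt (Some (lab v))) (wfs_step hv) ht'.
exists (i + (j + 1)); rewrite iterD [iter (j + 1) _ _]iterD /= /tour theta_up // -/tour.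
by rewrite /= hj.
Qed.

(* Distinct initial tapes have disjoint orbits, and an orbit that meets no halting
   configuration in its first [N] steps has at least [N] elements. *)
Lemma slow_orbits (T : finType) (start : T -> config (st M)) (tau : T -> seq bool)
    (N : nat) (slow : {set T}) :
  injective tau -> (forall i, wfs (start i) /\ exists o, ends (start i) o (tau i)) ->
  (forall i, i \in slow ->
     forall j, j < N -> ~~ halted_cfg (iter j tour (start i, None)).1) ->
  #|slow| * N <= #|{: code_type * slot}|.
Proof.
move=> inj_tau hs hslow.
pose f (p : T * 'I_N) :=
  let d := iter p.2 tour (start p.1, None) in (code d.1, d.2) : code_type * slot.
have wfsd i j : wfs (iter j tour (start i, None)).1.
  by apply: wfs_iter_tour; case: (hs i).
(* A repetition makes the orbit periodic with period [b - a]. The orbit does meet a halting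
   configuration, at some time [m], hence also at time [m %% (b - a) < N], contrary to slowness. *)
have period i a b : a < b -> b < N -> i \in slow ->
    iter a tour (start i, None) = iter b tour (start i, None) -> False.
  move=> ab bN hi; have [[wfi _ _] [o hend]] := hs i.
  rewrite -{1}(subnKC (ltnW ab)) iterD => E.
  have {}E : (start i, None) = iter (b - a) tour (start i, None).
    by apply: iter_tour_inj E => //; apply: wf_iter_tour.
  have [m hm] := reach_halted (proj1 (hs i)) hend.
  have per k : iter (k * (b - a)) tour (start i, None) = (start i, None).
    by elim: k => // k IHk; rewrite mulSn iterD IHk -E.
  move: hm; rewrite (divn_eq m (b - a)) addnC iterD per.
  apply/negP/hslow => //; apply: leq_trans (ltn_pmod _ _) _; lia.
have inj_f : {in setX slow setT &, injective f}.
  move=> [i a] [j b]; rewrite !in_setX /= => /andP[hi _] /andP[hj _] Ef.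
  have Ec := congr1 fst Ef; have Es := congr1 snd Ef.
  rewrite [fst _]/= [in RHS]/= in Ec; rewrite /= in Es.
  have E : iter a tour (start i, None) = iter b tour (start j, None).
    rewrite [LHS]surjective_pairing [RHS]surjective_pairing Es.
    by congr (_, _); apply: code_inj Ec.
  have [[wfi _ _] [oi ei]] := hs i; have [[wfj _ _] [oj ej]] := hs j.
  have Eij : i = j.
    apply: inj_tau.
    have : ends (iter a tour (start i, None)).1 oi (tau i) by rewrite ends_iter_tour.
    have : ends (iter a tour (start i, None)).1 oj (tau j) by rewrite E ends_iter_tour.
    by move=> h1 h2; case: (ends_fun h2 h1).
  rewrite -Eij in E *; congr (_, _); apply: val_inj => /=.
  apply/eqP; case: ltngtP => // lt; exfalso; first exact: (period i a b).
  exact: (period i b a).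
rewrite -[N]card_ord -cardsT -cardsX -(card_in_imset inj_f).
exact: max_card.
Qed.

End Tour.

(** * The simulating program *)

Section Program.

Variables (M : CatTM) (k : nat).

(* Direction (forward or back), second block?, state, slot, mode, recorded answer,
   side on which the input head is when it reads an end marker. *)
Definition run_state := (bool * bool * st M * slot M * bool * option bool * bool)%type.

(** [CA] and [CB] are the two rounds of [theta]. [CC] leaves the simulated configuration alone: it
    is the first state whose tests show the value of [T] incremented by [CB]. *)
Inductive control :=
  | CStart | CRew of 'I_k.+1 | CMul of 'I_k.+1 & option bool
  | CA of run_state | CB of run_state | CC of run_state
  | CShift of option bool | CHalt of option bool.

Definition control_code (c : control) :
    (option 'I_k.+1 + 'I_k.+1 * option bool) + (option bool * run_state + bool * option bool) :=
  match c with
  | CStart => inl (inl None) | CRew j => inl (inl (Some j)) | CMul j u => inl (inr (j, u))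
  | CA r => inr (inl (None, r)) | CB r => inr (inl (Some false, r))
  | CC r => inr (inl (Some true, r))
  | CShift a => inr (inr (false, a)) | CHalt a => inr (inr (true, a))
  end.
Definition control_decode
    (c : (option 'I_k.+1 + 'I_k.+1 * option bool) +
         (option bool * run_state + bool * option bool)) :=
  match c with
  | inl (inl None) => CStart | inl (inl (Some j)) => CRew j | inl (inr (j, u)) => CMul j u
  | inr (inl (None, r)) => CA r | inr (inl (Some false, r)) => CB r
  | inr (inl (Some true, r)) => CC r
  | inr (inr (false, a)) => CShift a | inr (inr (true, a)) => CHalt a
  end.
Lemma control_codeK : cancel control_code control_decode.
Proof. by case. Qed.
HB.instance Definition _ := Finite.copy control (can_type control_codeK).

Definition control_out (c : control) : option (option bool) :=
  if c is CHalt a then Some a else None.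

Definition quiet (ws : hsym) (addx incv incx copy : bool) : cmd :=
  Cmd (bitof ws) mvS addx false incv incx false copy.

Definition in_sym (side : bool) (xi : option bool) : hsym :=
  if xi is Some b then inr b else inl side.

(** Virtual end markers of the block: the left one at [V = 0], the right one at [V = X]. What the
    real head sees there is ignored. *)
Definition cat_sym (nzv eq : bool) (cc : option bool) : hsym :=
  if nzv then if eq then inl true else inr (odflt false cc) else inl false.

(** Both input markers read as [None], but the direction of the last effective move tells which one
    has been reached. *)
Definition new_side (side : bool) (m : move) : bool :=
  match m with mvL => false | mvS => side | mvR => true end.

(** On a virtual marker the real catalytic head is outside the block, so the bit found there is
    written back. The real tape would not block the head at the block boundary, hence the effective
    move [mc'], which [V] follows by decrement or increment. *)
Definition emit (f : bool -> control) (a : vaction M) (inct side : bool)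
    (ei ec : hsym) (cc : option bool) : control * cmd * bool * move * move :=
  let: (_, wb, cb, mi, mw, mc) := a in
  let mc' := eff ec mc in
  (f (new_side side (eff ei mi)),
   Cmd wb mw false (mc' == mvL) (mc' == mvR) false inct false,
   if ec is inr _ then cb else odflt false cc, mi, mc').

Definition act_state (a : vaction M) : st M := let: (q, _, _, _, _, _) := a in q.

Definition record_answer (ans : option bool) (q : st M) : option bool :=
  if halt_out M q is Some (Some o) then Some o else ans.

(** A saturating counter with values 0, 1, at least 2. Leaving the [CMul] loop only when the input
    is exhausted and two rounds are done yields [nn n = maxn n 2] rounds. *)
Definition count2 (u : option bool) : option bool :=
  if u is None then Some false else Some true.

Definition after_loop (d b : bool) (q : st M) (s : slot M) (ans : option bool) (side : bool) :=
  if d then CA (false, b, q, s, false, ans, side) else if b then CHalt ans else CShift ans.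

(* During the tours [X] is one more than the length of the simulated catalytic tape,
   [V] the position of the simulated catalytic head and [T] the round counter, which wraps
   to 0 after [N] rounds.  [CMul] and [CRew] compute [X]; [CShift] moves the catalytic head to
   the second block. *)
Definition program (c : control) (xi cc : option bool) (ws : hsym) (nzv eq nzt : bool) :
    control * cmd * bool * move * move :=
  let keep := odflt false cc in
  match c with
  | CStart => (CRew ord_max, quiet ws false false true false, keep, mvS, mvS)
  | CRew j =>
    if xi is Some _ then (CRew j, quiet ws false false false false, keep, mvL, mvS)
    else if j == 0 :> nat then
      (CA (true, false, start M, None, false, None, false),
       quiet ws false false true false, keep, mvS, mvS)
    else (CMul (inord j.-1) None, quiet ws false false false false, keep, mvR, mvS)
  | CMul j u =>
    if (xi != None) || (u != Some true) then
      (CMul j (count2 u), quiet ws true false false false, keep, mvR, mvS)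
    else (CRew j, quiet ws false false false true, keep, mvL, mvS)
  | CA (d, b, q, s, _, ans, side) =>
    let ei := in_sym side xi in let ec := cat_sym nzv eq cc in
    let: (s', mode, a) := decA (if d then s else prv s) q ei ws ec in
    emit (fun side' => CB (d, b, act_state a, s', mode,
                           if d then record_answer ans q else ans, side'))
      a false side ei ec cc
  | CB (d, b, q, s, mode, ans, side) =>
    let ei := in_sym side xi in let ec := cat_sym nzv eq cc in
    let: (s', a) := decB s mode q ei ws ec in
    emit (fun side' => CC (d, b, act_state a, if d then nxt s' else s', false, ans, side'))
      a true side ei ec cc
  | CC (d, b, q, s, _, ans, side) =>
    let ei := in_sym side xi in let ec := cat_sym nzv eq cc in
    emit (fun side' => if nzt then CA (d, b, q, s, false, ans, side')
                       else after_loop d b q s ans side')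
      (null_action q ws ec) false side ei ec cc
  | CShift ans =>
    if eq then
      (CA (true, true, start M, None, false, ans, false),
       quiet ws false false false true, keep, mvS, mvS)
    else (CShift ans, quiet ws false true false false, keep, mvS, mvR)
  | CHalt _ => (c, quiet ws false false false false, keep, mvS, mvS)
  end.

(** * Correctness of the program on the register machine *)

Variables (B l : nat) (x : seq bool).
Let N := modulus B l.
Let step1 := astep control_out program B l x.

Definition side_ok (side : bool) (p : nat) : Prop :=
  (p = 0 -> side = false) /\ (size x < p -> side = true).

Lemma in_symE side p : side_ok side p -> in_sym side (read x p) = eread x p.
Proof.
case=> h1 h2; rewrite ereadE /read; case: ifP => //= h.
by congr inl; have [p0|p0] := posnP p; [rewrite h1 ?p0|rewrite h2; lia].
Qed.

Lemma side_ok_move side p m : p <= (size x).+1 -> side_ok side p ->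
  side_ok (new_side side (eff (eread x p) m)) (do_move (size x) p m).
Proof.
move=> hp hs; rewrite do_move_eff //; case E: (eff (eread x p) m) => //=.
  have : eff (eread x p) mvL = mvL by rewrite -E eff_eff.
  by rewrite effL; split=> //; lia.
Qed.

Definition embed (c : control) (pre post : seq bool) (v : config (st M)) (T : nat) : ast control :=
  Ast c (ipos v) (size pre + cpos v) (pre ++ ctape v ++ post) (wtape v) (wpos v)
    (size (ctape v)).+1 (cpos v) T.

Lemma write_block pre t post p b : 0 < p <= size t ->
  write (pre ++ t ++ post) (size pre + p) b = pre ++ write t p b ++ post.
Proof.
move=> h; rewrite /write h ifT; last by rewrite !size_cat; lia.
apply: (@eq_from_nth _ false).
  rewrite size_set_nth !size_cat size_set_nth; have := size_write t p b; lia.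
move=> i _; rewrite nth_set_nth /= !nth_cat size_set_nth.
rewrite (_ : maxn p.-1.+1 (size t) = size t); last by lia.
case: eqP => [->|hi].
  rewrite ifN ?ifT; try lia.
  by rewrite nth_set_nth /= ifT //; lia.
case: ifP => // h1; case: ifP => // h2.
by rewrite nth_set_nth /= ifN //; apply/eqP; lia.
Qed.

Lemma read_block pre t post p : 0 < p <= size t ->
  read (pre ++ t ++ post) (size pre + p) = read t p.
Proof.
move=> h; rewrite /read h ifT; last by rewrite !size_cat; lia.
by congr Some; rewrite !nth_cat ifN ?ifT; [congr nth; lia|lia|lia].
Qed.

Lemma cat_symE pre t post p : p <= (size t).+1 ->
  cat_sym (p != 0) ((size t).+1 == p) (read (pre ++ t ++ post) (size pre + p)) = eread t p.
Proof.
move=> hp; rewrite /cat_sym /eread; case: eqP => //= p0; case: eqP => [<-|h].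
  by rewrite ltnn.
have pt : p <= size t by lia.
by rewrite pt read_block; [rewrite /read ifT //; lia|lia].
Qed.

Lemma astep_emit c pre post v T f (a : vaction M) inct side :
  (size (ctape v)).+1 < N -> T < N -> size pre + size (ctape v) < size (pre ++ ctape v ++ post) ->
  wf x v -> side_ok side (ipos v) -> control_out c = None ->
  program c (read x (ipos v)) (read (pre ++ ctape v ++ post) (size pre + cpos v))
    (esw v) (cpos v != 0) ((size (ctape v)).+1 == cpos v) (T != 0) =
  emit f a inct side (esi x v) (esc v) (read (pre ++ ctape v ++ post) (size pre + cpos v)) ->
  exists2 side', side_ok side' (ipos (vact x v a)) &
    step1 (embed c pre post v T) = embed (f side') pre post (vact x v a) ((T + inct) %% N).
Proof.
move=> hC hT hpost [h1 h2 h3] hside Ec Ep.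
exists (new_side side (eff (esi x v) (let: (_, _, _, mi, _, _) := a in mi))).
  case: a {Ep} => [[[[[q wb] cb] mi] mw] mc] /=.
  exact: side_ok_move.
rewrite /step1 /astep /= Ec -/(esw v) Ep.
case: a {Ep} => [[[[[q wb] cb] mi] mw] mc].
rewrite /emit /embed /vact /= size_write -/N.
have Emc : do_move (size (ctape v)) (cpos v) mc = umove (cpos v) (eff (esc v) mc).
  exact: do_move_eff.
congr Ast.
- rewrite Emc; move: hpost; rewrite !size_cat => hpost.
  case E: (eff (esc v) mc) => //=; last by lia.
  have : eff (esc v) mvL = mvL by rewrite -E eff_eff.
  by rewrite effL; lia.
- case Ee: (esc v) => [s|b].
    rewrite write_read; congr (_ ++ (_ ++ _)).
    by rewrite -[LHS](write_bitof (ctape v) (cpos v)) [RHS]write_setb_aux -!/(esc v) Ee.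
  rewrite write_block //; move: Ee; rewrite /esc ereadE; case: ifP => //.
- by rewrite addn0 modn_small.
- rewrite Emc mul0n; case E: (eff (esc v) mc) => /=.
  + have : eff (esc v) mvL = mvL by rewrite -E eff_eff.
    rewrite effL => p0.
    (* The decrement adds [N - 1]; as [V > 0], this is [N] plus the predecessor, and the reduction
       removes [N]. *)
    rewrite addn0 (_ : _ + _ = N + (cpos v).-1); last by lia.
    by rewrite modnDl modn_small //; lia.
  + by rewrite !addn0 modn_small //; lia.
  + have : eff (esc v) mvR = mvR by rewrite -E eff_eff.
    by rewrite effR addn0 => pc; rewrite modn_small; lia.
Qed.

Lemma act_stateE v a : cst (vact x v a) = act_state a.
Proof. by case: a => [[[[[q wb] cb] mi] mw] mc]. Qed.

Definition tour_dir (d : bool) (e : dart M) : dart M := if d then tour x e else untour x e.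

Lemma wf_tour_dir d e : wf x e.1 -> wf x (tour_dir d e).1.
Proof. by case: d => h; [apply: wf_tour|apply: wf_theta]. Qed.

Lemma size_vact v (a : vaction M) : size (ctape (vact x v a)) = size (ctape v).
Proof. by case: a => [[[[[q wb] cb] mi] mw] mc]; rewrite /= size_write. Qed.

Lemma size_tour_dir d e : size (ctape (tour_dir d e).1) = size (ctape e.1).
Proof.
rewrite /tour_dir /tour /untour /theta /thetaA /thetaB.
case: d; case: decA => [[s m] a] /=; case: decB => [s' a']; by rewrite /= !size_vact.
Qed.

Lemma tour_round d b pre post v s ans side T :
  (size (ctape v)).+1 < N -> T < N -> size pre + size (ctape v) < size (pre ++ ctape v ++ post) ->
  wf x v -> side_ok side (ipos v) ->
  let e := tour_dir d (v, s) in
  let T' := T.+1 %% N in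
  let ans' := if d then record_answer ans (cst v) else ans in
  exists2 side', side_ok side' (ipos e.1) &
    iter 3 step1 (embed (CA (d, b, cst v, s, false, ans, side)) pre post v T) =
    embed (if T' != 0 then CA (d, b, cst e.1, e.2, false, ans', side')
           else after_loop d b (cst e.1) e.2 ans' side') pre post e.1 T'.
Proof.
move=> hC hT hpost hwf hside e T' ans'.
set s0 := if d then s else prv s.
case EA : (decA s0 (cst v) (esi x v) (esw v) (esc v)) => [[s1 mode] a].
have [h1 h2 h3] := hwf.
have [side1 ok1 E1] := @astep_emit (CA (d, b, cst v, s, false, ans, side)) pre post v T
  (fun side' => CB (d, b, act_state a, s1, mode, ans', side')) a false side hC hT hpost hwf hside
  erefl ltac:(by rewrite /= in_symE // cat_symE // -/(esi x v) -/(esc v) EA).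
set v1 := vact x v a in ok1 E1.
have sz1 : size (ctape v1) = size (ctape v) by apply: size_vact.
have hwf1 : wf x v1 by apply: wf_vact.
have [k1 k2 k3] := hwf1.
case EB : (decB s1 mode (cst v1) (esi x v1) (esw v1) (esc v1)) => [s2 a2].
have hpost1 : size pre + size (ctape v1) < size (pre ++ ctape v1 ++ post).
  by move: hpost; rewrite !size_cat sz1.
have [side2 ok2 E2] := @astep_emit (CB (d, b, act_state a, s1, mode, ans', side1)) pre post v1 T
  (fun side' => CC (d, b, act_state a2, if d then nxt s2 else s2, false, ans', side'))
  a2 true side1 ltac:(by rewrite sz1) hT hpost1 hwf1 ok1
  erefl ltac:(by rewrite /= in_symE // cat_symE // -/(esi x v1) -/(esc v1) -(act_stateE v a) EB).
set v2 := vact x v1 a2 in ok2 E2.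
have sz2 : size (ctape v2) = size (ctape v) by rewrite size_vact.
have hwf2 : wf x v2 by apply: wf_vact.
have [l1 l2 l3] := hwf2.
have hpost2 : size pre + size (ctape v2) < size (pre ++ ctape v2 ++ post).
  by move: hpost; rewrite !size_cat sz2.
have Ee : e = (v2, if d then nxt s2 else s2).
  rewrite /e /tour_dir /tour /untour /theta /thetaA.
  by case: (d) @s0 EA => s0 EA; rewrite /= EA /= -/v1 EB.
have hN : 0 < N by rewrite /N /modulus expn_gt0.
have [side3 ok3 E3] := @astep_emit (CC (d, b, cst v2, if d then nxt s2 else s2, false, ans', side2))
  pre post v2 T'
  (fun side' => if T' != 0 then CA (d, b, cst v2, if d then nxt s2 else s2, false, ans', side')
     else after_loop d b (cst v2) (if d then nxt s2 else s2) ans' side')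
  (null_action (cst v2) (esw v2) (esc v2)) false side2 ltac:(by rewrite sz2)
  (ltn_pmod _ hN) hpost2 hwf2 ok2
  erefl ltac:(by rewrite /= in_symE // cat_symE // -/(esi x v2) -/(esc v2)).
rewrite vact_null in ok3 E3.
exists side3; first by rewrite Ee.
rewrite !iterS /= E1 addn0 (modn_small hT) E2 Ee /=; rewrite addn1 -/T' -(act_stateE v1 a2) -/v2 E3.
by rewrite addn0 modn_mod.
Qed.

Fixpoint answers (d : bool) (e : dart M) (ans : option bool) (i : nat) : option bool :=
  if i is i'.+1 then
    let a := answers d e ans i' in
    if d then record_answer a (cst (iter i' (tour_dir d) e).1) else a
  else ans.

Lemma wf_iter_dir d e i : wf x e.1 -> wf x (iter i (tour_dir d) e).1.
Proof. by move=> h; elim: i => //= i; apply: wf_tour_dir. Qed.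

Lemma size_iter_dir d e i : size (ctape (iter i (tour_dir d) e).1) = size (ctape e.1).
Proof. by elim: i => //= i <-; apply: size_tour_dir. Qed.

(** [T] starts at 0 and is first 0 again after [N] rounds, so the overflow is the exit test and also
    resets the counter for the next loop. The last round is treated apart because it leaves through
    [after_loop]. *)
Lemma tour_loop d b pre post e ans side :
  (size (ctape e.1)).+1 < N -> size pre + size (ctape e.1) < size (pre ++ ctape e.1 ++ post) ->
  wf x e.1 -> side_ok side (ipos e.1) ->
  let e' := iter N (tour_dir d) e in
  exists2 side', side_ok side' (ipos e'.1) &
    iter (3 * N) step1 (embed (CA (d, b, cst e.1, e.2, false, ans, side)) pre post e.1 0) =
    embed (after_loop d b (cst e'.1) e'.2 (answers d e ans N) side') pre post e'.1 0.
Proof.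
move=> hC hpost hwf hside e'.
have hN : 0 < N by rewrite /N /modulus expn_gt0.
have rounds i : i < N -> exists2 side', side_ok side' (ipos (iter i (tour_dir d) e).1) &
    iter (3 * i) step1 (embed (CA (d, b, cst e.1, e.2, false, ans, side)) pre post e.1 0) =
    embed (CA (d, b, cst (iter i (tour_dir d) e).1, (iter i (tour_dir d) e).2, false,
      answers d e ans i, side')) pre post (iter i (tour_dir d) e).1 i.
  elim: i => [|i IH] hi; first by exists side.
  have [side1 ok1 E1] := IH (ltnW hi).
  rewrite mulnS iterD E1.
  have := @tour_round d b pre post (iter i (tour_dir d) e).1 (iter i (tour_dir d) e).2
    (answers d e ans i) side1 i.
  rewrite -surjective_pairing size_iter_dir modn_small //= => H.
  have hp : size pre + size (ctape e.1) <
      size (pre ++ ctape (iter i (tour_dir d) e).1 ++ post).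
    by move: hpost; rewrite !size_cat size_iter_dir.
  have [side2 ok2 E2] := H hC (ltnW hi) hp (wf_iter_dir d i hwf) ok1.
  by exists side2.
have [side1 ok1 E1] := rounds N.-1 ltac:(by rewrite prednK).
have E3 : 3 * N = 3 + 3 * N.-1 by rewrite -mulnS prednK.
rewrite E3 iterD E1.
have := @tour_round d b pre post (iter N.-1 (tour_dir d) e).1 (iter N.-1 (tour_dir d) e).2
  (answers d e ans N.-1) side1 N.-1.
rewrite -surjective_pairing size_iter_dir prednK // modnn /= => H.
have hp : size pre + size (ctape e.1) <
    size (pre ++ ctape (iter N.-1 (tour_dir d) e).1 ++ post).
  by move: hpost; rewrite !size_cat size_iter_dir.
have [side2 ok2 E2] := H hC (leqnn N) hp (wf_iter_dir d N.-1 hwf) ok1.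
have EN : e' = tour_dir d (iter N.-1 (tour_dir d) e) by rewrite -iterS prednK.
exists side2; first by rewrite EN.
have EA : answers d e ans N = answers d e ans N.-1.+1 by rewrite prednK.
by rewrite EA EN E2.
Qed.

Definition start_ctl (b : bool) (ans : option bool) : control :=
  CA (true, b, start M, None, false, ans, false).

(** Each direction costs [3 * N]. Since [untour] undoes [tour], the simulated heads, work tape and
    block are back in their initial state, ready for the other block. *)
Lemma block_run b pre post s sigma ans :
  (size sigma).+1 < N -> size pre + size sigma < size (pre ++ sigma ++ post) ->
  let v := init M s sigma in
  iter (6 * N) step1 (embed (start_ctl b ans) pre post v 0) =
  embed (if b then CHalt (answers true (v, None) ans N) else
         CShift (answers true (v, None) ans N)) pre post v 0.
Proof.
move=> hC hpost v.
have hwf : wf x v by [].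
have hs : side_ok false (ipos v) by split.
have [side1 ok1 E1] := @tour_loop true b pre post (v, None) ans false hC hpost hwf hs.
set e1 := iter N (tour_dir true) (v, None) in ok1 E1.
have sz1 : size (ctape e1.1) = size sigma by rewrite size_iter_dir.
have hpost1 : size pre + size (ctape e1.1) < size (pre ++ ctape e1.1 ++ post).
  by move: hpost; rewrite !size_cat sz1.
have [side2 ok2 E2] := @tour_loop false b pre post e1 (answers true (v, None) ans N) side1
  ltac:(by rewrite sz1) hpost1 (@wf_iter_dir true (v, None) N hwf) ok1.
have Eb : iter N (tour_dir false) e1 = (v, None) by exact: (@iter_tourK M x N (v, None) hwf).
rewrite (_ : 6 * N = 3 * N + 3 * N); last by lia.
rewrite iterD [iter (3 * N) _ (embed _ _ _ _ _)]E1 E2 Eb /=.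
have Ea i : answers false e1 (answers true (v, None) ans N) i = answers true (v, None) ans N.
  by elim: i => //= i ->.
by rewrite Ea.
Qed.

Definition shift_ast (s : nat) (ct : seq bool) (C : nat) (ans : option bool)
    (i : nat) : ast control :=
  Ast (CShift ans) 0 i ct (nseq s false) 0 C.+1 i 0.

(** [V] counts the moves of the real head until it equals [X = C.+1]; the copy in the last step then
    keeps [X] and resets [V] to 0. *)
Lemma shift_run s ct C ans : C.+1 < N -> C < size ct ->
  iter C.+2 step1 (shift_ast s ct C ans 0) =
  Ast (start_ctl true ans) 0 C.+1 ct (nseq s false) 0 C.+1 0 0.
Proof.
move=> hC hct.
have hN : 0 < N by rewrite /N /modulus expn_gt0.
have shift i : i <= C.+1 -> iter i step1 (shift_ast s ct C ans 0) = shift_ast s ct C ans i.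
  elim: i => // i IH hi; rewrite iterS IH; last exact: ltnW.
  rewrite /step1 /astep /= (_ : C.+1 == i = false); last by lia.
  rewrite /= write_read mul0n !addn0 -/N !modn_small //; try lia.
  rewrite /shift_ast; congr Ast => //; lia.
rewrite iterS shift // /step1 /astep /= eqxx /= write_read mul0n !addn0 -/N mod0n modn_small //.
Qed.

Definition setup_ast (s : nat) (ct : seq bool) (c : control) (ip X V : nat) : ast control :=
  Ast c ip 0 ct (nseq s false) 0 X V 0.

Definition cnt (i : nat) : option bool :=
  if i is i'.+1 then if i' == 0 then Some false else Some true else None.

Lemma count2_cnt i : count2 (cnt i) = cnt i.+1.
Proof. by case: i => [|[|i]]. Qed.

Let n := size x.

Lemma mul_loop s ct j c i : c <= N.-1 -> i <= nn n -> nn n * c < N ->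
  iter i step1 (setup_ast s ct (CMul j None) 1 c 0) =
  setup_ast s ct (CMul j (cnt i)) (minn i.+1 n.+1) c (i * c).
Proof.
move=> hc; elim: i => [|i IH] hi hN; first by rewrite /= mul0n; congr setup_ast; lia.
rewrite iterS IH //; last exact: ltnW.
have hN' : i.+1 * c < N by apply: leq_ltn_trans hN; rewrite leq_mul2r hi orbT.
have hcond : (read x (minn i.+1 n.+1) != None) || (cnt i != Some true).
  move: hi; rewrite /nn /read -/n; case: (i) => [|[|i']]; rewrite ?orbT // => hi.
  by rewrite ifT //; lia.
rewrite /step1 /astep /setup_ast /= hcond /= write_read count2_cnt -/N !addn0 mul1n modn_small;
  last by lia.
rewrite mod0n modn_small; last by rewrite mulSn addnC in hN'.
congr Ast; [rewrite -/n; lia | by rewrite mulSn addnC].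
Qed.

Lemma rewind s ct j c p : c < N -> p <= n ->
  iter p step1 (setup_ast s ct (CRew j) p c 0) = setup_ast s ct (CRew j) 0 c 0.
Proof.
move=> hc; elim: p => // p IH hp; rewrite iterSr -(IH (ltnW hp)); congr iter.
rewrite /step1 /astep /= {1}/read -/n hp /= write_read -/N mod0n addn0 modn_small //.
Qed.

(** The time is one step into the loop, [nn n] additions of [X] to [V], one step copying the product
    into [X], and [n] steps rewinding the input head. *)
Lemma multiply s ct (j : 'I_k.+1) c : j != 0 :> nat -> 0 < c -> nn n * c < N ->
  iter (nn n + n + 2) step1 (setup_ast s ct (CRew j) 0 c 0) =
  setup_ast s ct (CRew (inord j.-1)) 0 (nn n * c) 0.
Proof.
move=> hj c0 hN.
have hc : c < N by apply: leq_ltn_trans hN; rewrite /nn; nia.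
have n2 : nn n <= N.-1 by rewrite /nn in hN *; nia.
have E1 : step1 (setup_ast s ct (CRew j) 0 c 0) = setup_ast s ct (CMul (inord j.-1) None) 1 c 0.
  rewrite /step1 /astep /= (negbTE hj) /= write_read -/N mod0n addn0 modn_small //.
  by rewrite /setup_ast; congr Ast; rewrite -/n; lia.
have E2 : step1 (setup_ast s ct (CMul (inord j.-1) (cnt (nn n))) n.+1 c (nn n * c)) =
    setup_ast s ct (CRew (inord j.-1)) n (nn n * c) 0.
  rewrite /step1 /astep /= {1}/read ltnn /= -/n.
  have -> : cnt (nn n) = Some true by rewrite /nn; case: (n) => [|[|n']].
  by rewrite /= write_read -/N mod0n !addn0 modn_small.
rewrite (_ : nn n + n + 2 = n + (1 + (nn n + 1))); last by lia.
rewrite iterD [iter (1 + _) _ _]iterD [iter (nn n + 1) _ _]iterD /= E1 mul_loop //; last by lia.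
rewrite (_ : minn (nn n).+1 n.+1 = n.+1); last by rewrite /nn; lia.
by rewrite E2 rewind.
Qed.

Definition setup_time : nat := 2 + k * (nn n + n + 2).

Lemma setup_run s ct : let C := nn n ^ k in C.+1 < N ->
  iter setup_time step1 (setup_ast s ct CStart 0 0 0) =
  setup_ast s ct (start_ctl false None) 0 C.+1 0.
Proof.
move=> C hC.
have n0 : 0 < nn n by rewrite /nn; lia.
have E1 : step1 (setup_ast s ct CStart 0 0 0) = setup_ast s ct (CRew ord_max) 0 1 0.
  rewrite /step1 /astep /= write_read -/N mod0n modn_small //.
  by rewrite /C in hC; have := expn_gt0 (nn n) k; lia.
have E2 i : i <= k -> iter (i * (nn n + n + 2)) step1 (setup_ast s ct (CRew ord_max) 0 1 0) =
    setup_ast s ct (CRew (inord (k - i))) 0 (nn n ^ i) 0.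
  elim: i => [|i IH] hi.
    rewrite mul0n subn0 /=; congr setup_ast; congr CRew.
    by apply: val_inj; rewrite /= inordK.
  rewrite mulSn iterD IH; last exact: ltnW.
  rewrite multiply ?inordK ?expn_gt0 ?n0 //; try lia.
    by rewrite -expnS; congr setup_ast; congr CRew; congr inord; lia.
  by rewrite -expnS; apply: leq_ltn_trans (ltnW hC); rewrite leq_pexp2l.
rewrite /setup_time (_ : 2 + k * (nn n + n + 2) = 1 + (k * (nn n + n + 2) + 1)); last by lia.
rewrite iterD [iter (_ + 1) _ _]iterD /= E1 E2 // subnn.
rewrite /step1 /astep /= inordK //= write_read -/N mod0n addn1 modn_small //.
Qed.

Definition total_time : nat := setup_time + (6 * N + ((nn n ^ k).+2 + 6 * N)).

(** The cell at position [C.+1] lies between the blocks: it is the right marker of the first and the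
    left marker of the second, whence [drop C.+1]. *)
Lemma program_run s ct :
  let C := nn n ^ k in C.+1 < N -> C.+1 + C < size ct ->
  let answer1 := answers true (init M s (take C ct), None) None N in
  let answer2 := answers true (init M s (take C (drop C.+1 ct)), None) answer1 N in
  let a := iter total_time step1 (setup_ast s ct CStart 0 0 0) in
  control_out (actl a) = Some answer2 /\ act a = ct.
Proof.
move=> C hC hct answer1 answer2 a.
have s1 : size (take C ct) = C by rewrite size_takel //; lia.
have E0 : ct = [::] ++ take C ct ++ drop C ct by rewrite /= cat_take_drop.
have R1 : iter (6 * N) step1 (setup_ast s ct (start_ctl false None) 0 C.+1 0) =
    shift_ast s ct C answer1 0.
  have := @block_run false [::] (drop C ct) s (take C ct) None.
  rewrite s1 /embed /= s1 cat_take_drop => -> //.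
  by rewrite /= add0n; lia.
have s2 : size (take C (drop C.+1 ct)) = C by rewrite size_takel // size_drop; lia.
have s3 : size (take C.+1 ct) = C.+1 by rewrite size_takel //; lia.
have R2 : iter (6 * N) step1 (Ast (start_ctl true answer1) 0 C.+1 ct (nseq s false) 0 C.+1 0 0) =
    Ast (CHalt answer2) 0 C.+1 ct (nseq s false) 0 C.+1 0 0.
  have := @block_run true (take C.+1 ct) (drop C (drop C.+1 ct)) s (take C (drop C.+1 ct)) answer1.
  rewrite s2 s3 /embed /= s2 s3 !cat_take_drop addn0 => -> //.
rewrite /a (_ : total_time = 6 * N + (C.+2 + (6 * N + setup_time))); last first.
  by rewrite /total_time -/C; lia.
rewrite iterD [iter (C.+2 + _) _ _]iterD [iter (6 * N + _) _ _]iterD setup_run // R1.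
rewrite shift_run //; last by lia.
by rewrite R2.
Qed.

End Program.

(** * Counting and bounds *)

Section Answers.

Variables (M : CatTM) (x : seq bool).

(** By [ends_iter_tour] a halting configuration met on the tour carries the output that [M] itself
    gives from [v]. *)
Lemma answers_step v o tau i : wf x v -> ends x v o tau ->
  let w := (iter i (tour_dir (M := M) x true) (v, None)).1 in
  forall ans, record_answer ans (cst w) =
    if halted_cfg w then (if o is Some b then Some b else ans) else ans.
Proof.
move=> hv he w ans; rewrite /record_answer /halted_cfg.
case E: (halt_out M (cst w)) => [o'|] //=.
have e1 : ends x w o tau by rewrite ends_iter_tour.
have e2 : ends x w o' (ctape w) by exists 0.
by have [-> _] := ends_fun e1 e2; case: o' {E e2}.
Qed.

Lemma answersE v o tau ans n : wf x v -> ends x v o tau ->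
  answers x true (v, None) ans n =
    if [exists i : 'I_n, halted_cfg (iter i (tour (M := M) x) (v, None)).1]
    then (if o is Some b then Some b else ans) else ans.
Proof.
move=> hv he; elim: n => [|n IH] /=; first by case: existsP => // -[[]].
rewrite (answers_step _ hv he) IH.
case: ifP => h.
  rewrite (_ : [exists i : 'I_n.+1, _] = true); last by apply/existsP; exists ord_max.
  by case: ifP => //; case: (o).
congr (if _ then _ else _); apply/existsP/existsP => [[i hi]|[i hi]].
  by exists (widen_ord (leqnSn n) i).
have := ltn_ord i; rewrite ltnS leq_eqVlt => /orP[/eqP E|lt].
  by move: h; rewrite -E => h; rewrite h in hi.
by exists (Ordinal lt).
Qed.

End Answers.

Lemma halts_restores_ends M x s tau t o :
  halts_restores_with M x s tau t o -> ends x (init M s tau) o tau.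
Proof. by move=> [h1 h2]; exists t. Qed.

Section Counting.

Variables (C C' : nat) (bad : {set C.-tuple bool}).
Hypothesis hCC : C.+1 + C < C'.

Definition block (off : nat) (tau : C'.-tuple bool) : C.-tuple bool :=
  [tuple nth false tau (off + i) | i < C].

Lemma blockE off tau : off + C <= C' -> block off tau = take C (drop off tau) :> seq bool.
Proof.
move=> h; apply: (@eq_from_nth _ false).
  by rewrite size_tuple size_takel // size_drop size_tuple; lia.
rewrite size_tuple => i hi; rewrite nth_take // nth_drop.
by rewrite -[i]/(val (Ordinal hi)) -tnth_nth tnth_mktuple.
Qed.

Definition both_bad : {set C'.-tuple bool} :=
  [set tau | (block 0 tau \in bad) && (block C.+1 tau \in bad)].

Lemma card_both_bad : #|both_bad| <= #|bad| ^ 2 * 2 ^ (C' - 2 * C).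
Proof.
(* The cells outside both blocks are the separator at index [C] and those from index [2 * C + 1] on;
   index 0 of [rest] is assigned to the separator. *)
pose rest (tau : C'.-tuple bool) : {ffun 'I_(C' - 2 * C) -> bool} :=
  [ffun i : 'I_(C' - 2 * C) => nth false tau (if i == 0 :> nat then C else 2 * C + i)].
pose f (tau : C'.-tuple bool) := (block 0 tau, block C.+1 tau, rest tau).
have inj_f : injective f.
  move=> t1 t2 E; have E3 := congr1 snd E; have E1 := congr1 (fun p => p.1.1) E.
  have E2 := congr1 (fun p => p.1.2) E; rewrite /= in E1 E2 E3.
  apply: val_inj; apply: (@eq_from_nth _ false).
    by rewrite !size_tuple.
  rewrite size_tuple => i hi.
  have eqb off j : off + C <= C' -> j < C -> block off t1 = block off t2 ->
      nth false t1 (off + j) = nth false t2 (off + j).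
    move=> _ hj /(congr1 (fun t => tnth t (Ordinal hj))); by rewrite !tnth_mktuple.
  have eqr j : j < C' - 2 * C -> nth false t1 (if j == 0 then C else 2 * C + j) =
      nth false t2 (if j == 0 then C else 2 * C + j).
    by move=> hj; move/ffunP: E3 => /(_ (Ordinal hj)); rewrite !ffunE.
  have [h1|h1] := ltnP i C; first by apply: (eqb 0 i) => //; lia.
  have [->|h2] := eqVneq i C; first by apply: (eqr 0); lia.
  have [h3|h3] := ltnP i (C.+1 + C).
    have h4 : C < i by rewrite ltn_neqAle eq_sym h2.
    by rewrite -(subnKC h4); apply: eqb => //; lia.
  have := eqr (i - 2 * C) ltac:(by lia); rewrite ifN; last by lia.
  by rewrite subnKC //; lia.
have -> : #|bad| ^ 2 * 2 ^ (C' - 2 * C) =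
    #|setX (setX bad bad) [set: {ffun 'I_(C' - 2 * C) -> bool}]|.
  by rewrite !cardsX cardsT card_ffun card_bool card_ord.
rewrite -(card_imset _ inj_f); apply: subset_leq_card; apply/subsetP => p /imsetP[tau].
by rewrite inE => /andP[h1 h2] ->; rewrite !inE /= h1 h2.
Qed.

Lemma card_not_both_bad : 8 * #|bad| <= 5 * 2 ^ C -> 2 ^ C' <= 2 * #|~: both_bad|.
Proof.
move=> h.
have h2 : 64 * #|both_bad| <= 25 * 2 ^ C'.
  have -> : 2 ^ C' = 2 ^ C * 2 ^ C * 2 ^ (C' - 2 * C) by rewrite -!expnD; congr expn; lia.
  have := card_both_bad; have := expn_gt0 2 (C' - 2 * C); move: h.
  move: #|bad| #|both_bad| (2 ^ C) (2 ^ (C' - 2 * C)) => b bb u v h v0 hb.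
  have : (8 * b) * (8 * b) <= (5 * u) * (5 * u) by apply: leq_mul.
  nia.
have := cardsC both_bad; rewrite card_tuple card_bool; lia.
Qed.

End Counting.

Section Bounds.

Variable n : nat.
Let u := nn n.
Let l := up_log 2 u.

Lemma nn_ge2 : 2 <= u. Proof. by rewrite /u /nn; lia. Qed.

Lemma pow_le i j : i <= j -> u ^ i <= u ^ j.
Proof. by have := nn_ge2 => h; rewrite leq_exp2l. Qed.

Lemma two_pow_le i : 2 ^ i <= u ^ i.
Proof. by case: i => // i; rewrite leq_exp2r // nn_ge2. Qed.

Lemma u_le_2l : u <= 2 ^ l. Proof. by apply: up_logP. Qed.

(** Rounding the logarithm up costs less than a factor 2, which is at most [u]. *)
Lemma two_l_le : 2 ^ l <= u ^ 2.
Proof.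
have h := nn_ge2; have /andP[h1 _] := up_log_bounds (isT : 1 < 2) h.
have l0 : 0 < l by rewrite up_log_gt0 h.
rewrite -(prednK l0) expnS expnS expn1; apply: leq_mul => //; exact: ltnW.
Qed.

Lemma pow_modulus_ge B : u ^ B.+1 <= modulus B l.
Proof. by rewrite /modulus mulnC expnM leq_exp2r // u_le_2l. Qed.

Lemma pow_modulus_le B : modulus B l <= u ^ (2 * B.+1).
Proof. by rewrite /modulus mulnC !expnM leq_exp2r // two_l_le. Qed.

Lemma succ_le_pow a m : m <= u ^ a -> m.+2 <= u ^ (a + 2).
Proof.
move=> h; have := nn_ge2; have : 0 < u ^ a by rewrite expn_gt0; have := nn_ge2; lia.
rewrite expnD expnS expn1 => h0 h2; have : 4 <= u * u by nia.
move: (u ^ a) (u * u) h h0 => p q; nia.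
Qed.

Lemma lin_le_pow a m : m <= 2 ^ a -> m <= u ^ a.
Proof. by move=> h; apply: leq_trans h (two_pow_le a). Qed.

Lemma mul_le_pow a b p q : p <= u ^ a -> q <= u ^ b -> p * q <= u ^ (a + b).
Proof. by move=> h1 h2; rewrite expnD leq_mul. Qed.

(** Every factor is bounded by a power of [u], constants included since [2 <= u]. The exponents [3],
    [state_slots], [3], [2 * k + 2], [k + 2], [2 * k] add up to [state_slots + 5 * k + 10], which is
    the origin of [digits]. *)
Lemma state_count (state_slots k B : nat) : state_slots + 5 * k + 9 <= B ->
  8 * (state_slots * n.+2 * (k * l).+2 * (u ^ k).+2 * 2 ^ (k * l)) <= modulus B l.
Proof.
move=> hB; apply: leq_trans (pow_modulus_ge B).
have h8 : 8 <= u ^ 3 by apply: lin_le_pow.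
have hq : state_slots <= u ^ state_slots by apply: lin_le_pow; apply: ltnW; apply: ltn_expl.
have hn : n.+2 <= u ^ 3 by apply: (@succ_le_pow 1); rewrite expn1 /u /nn; lia.
have h2s : 2 ^ (k * l) <= u ^ (2 * k).
  by rewrite mulnC !expnM; case: (k) => // k'; rewrite leq_exp2r // two_l_le.
have hs : (k * l).+2 <= u ^ (2 * k + 2).
  by apply: succ_le_pow; apply: leq_trans h2s; apply: ltnW; apply: ltn_expl.
have hC : (u ^ k).+2 <= u ^ (k + 2) by apply: succ_le_pow.
have H := mul_le_pow h8 (mul_le_pow (mul_le_pow (mul_le_pow (mul_le_pow hq hn) hs) hC) h2s).
apply: leq_trans H _; apply: pow_le; lia.
Qed.

Lemma block_fits k B : k < B -> (u ^ k).+1 < modulus B l.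
Proof.
move=> h; apply: leq_trans (pow_modulus_ge B); apply: leq_trans (@succ_le_pow k _ (leqnn _)) _.
by apply: pow_le; lia.
Qed.

Lemma blocks_fit k k' : k + 3 <= k' -> (u ^ k).+1 + u ^ k < u ^ k'.
Proof.
move=> h; apply: (@leq_trans (u ^ (k + 3))); last exact: pow_le.
rewrite expnD; have : 8 <= u ^ 3 by apply: lin_le_pow.
have : 0 < u ^ k by rewrite expn_gt0; have := nn_ge2; lia.
move: (u ^ k) (u ^ 3) => p q; nia.
Qed.

(** The exponent [7 * B.+1] is dictated by the work tape with seven cells per column; the time needs
    only [3 * B.+1 + 11]. *)
Lemma time_fits (k B : nat) (x : seq bool) : size x = n -> k + 5 <= B ->
  (total_time k B l x).+1 * (2 * (7 * (B.+1 * l)) + 3) <= u ^ (7 * B.+1).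
Proof.
move=> hx hB; set N := modulus B l.
have N64 : 64 <= N.
  apply: leq_trans (pow_modulus_ge B); apply: leq_trans (two_pow_le B.+1).
  by rewrite -[64]/(2 ^ 6) leq_exp2l //; lia.
have hk : k * (u + n + 2) <= N.
  apply: leq_trans (pow_modulus_ge B); apply: (@leq_trans (u ^ (k + 3)));
    last by apply: pow_le; lia.
  apply: mul_le_pow; first by apply: lin_le_pow; apply: ltnW; apply: ltn_expl.
  have h2 := nn_ge2; have hn : n <= u by rewrite /u /nn; lia.
  have : 4 <= u ^ 2 by apply: lin_le_pow.
  by rewrite (expnS u 2); nia.
have hC : (u ^ k).+1 < N by apply: block_fits; lia.
have ht : (total_time k B l x).+1 <= u ^ (4 + 2 * B.+1).
  have h16 : 16 <= u ^ 4 by apply: lin_le_pow.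
  apply: (@leq_trans (16 * N)); last by apply: mul_le_pow; last exact: pow_modulus_le.
  by rewrite /total_time /setup_time hx -/u -/N; lia.
have hs : 2 * (7 * (B.+1 * l)) + 3 <= u ^ (5 + (B.+1 + 2)).
  have l0 : 0 < l by rewrite up_log_gt0 nn_ge2.
  apply: (@leq_trans (32 * (B.+1 * l))); first by nia.
  apply: mul_le_pow; first by apply: lin_le_pow.
  apply: mul_le_pow; first by apply: lin_le_pow; apply: ltnW; apply: ltn_expl.
  by apply: leq_trans two_l_le; apply: ltnW; apply: ltn_expl.
apply: leq_trans (mul_le_pow ht hs) _; apply: pow_le; lia.
Qed.

End Bounds.

(** * Assembly of the simulating machine *)

Section Simulation.

Variables (M : CatTM) (k : nat) (L : pred (seq bool)).
Hypothesis hM : ZP_decides M (logspace k) (polybound k) L.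

Definition state_slots : nat := #|st M| * #|{: slot M}|.
Definition digits : nat := state_slots + 5 * k + 9.
Definition simulator : CatTM := column_TM (CStart M k) (@control_out M k) (@program M k) k digits.

Lemma simulator_halts x (tau : seq bool) :
  let C := polybound k (size x) in
  let s := logspace k (size x) in
  let N := modulus digits (up_log 2 (nn (size x))) in
  let k' := 7 * digits.+1 in
  size tau = polybound k' (size x) ->
  let answer1 := answers x true (init M s (take C tau), None) None N in
  halts_restores_with simulator x (logspace k' (size x)) tau (polybound k' (size x))
    (answers x true (init M s (take C (drop C.+1 tau)), None) answer1 N).
Proof.
move=> C s N k' ht answer1; pose l := up_log 2 (nn (size x)).
have hk : k <= digits.+1 by rewrite /digits; lia.
have Es : logspace k' (size x) = 7 * (digits.+1 * l) by rewrite /logspace /k' -/l mulnA.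
have h1 : (nn (size x) ^ k).+1 < modulus digits l by apply: block_fits; rewrite /digits; lia.
have h2 : (nn (size x) ^ k).+1 + nn (size x) ^ k < size tau.
  by rewrite ht; apply: blocks_fit; rewrite /k' /digits; lia.
have [/= R1 R2] := @program_run M k digits l x s tau h1 h2.
have [H1 H2] := @column_TM_run _ (CStart M k) (@control_out M k) (@program M k) k digits l hk x tau
  (total_time k digits l x).
have {}H1 := etrans H1 R1; have {}H2 := etrans H2 R2; rewrite -/simulator in H1 H2.
have hT : (total_time k digits l x).+1 * (2 * (7 * (digits.+1 * l)) + 3) <= polybound k' (size x).
  by apply: time_fits => //; rewrite /digits; lia.
rewrite /halts_restores_with /run -(subnK hT) iterD Es.
by rewrite -/(run simulator x _ tau _) iter_step_halt H1.
Qed.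

Lemma simulator_decides :
  ZP_decides simulator (logspace (7 * digits.+1)) (polybound (7 * digits.+1)) L.
Proof.
move=> x; set k' := 7 * digits.+1; set n := size x.
set C := polybound k n; set C' := polybound k' n; set s := logspace k n.
set N := modulus digits (up_log 2 (nn n)).
have [hall [A [cardA hA]]] := hM x.
have hCC : C.+1 + C < C' by apply: blocks_fit; rewrite /k' /digits; lia.
have wfi (sigma : seq bool) : wf x (init M s sigma) by [].
pose fast (sigma : C.-tuple bool) :=
  [exists i : 'I_N, halted_cfg (iter i (tour (M := M) x) (init M s sigma, None)).1].
pose slow := [set sigma | ~~ fast sigma].
pose bad := ~: A :|: slow.
have hslow : 8 * #|slow| <= 2 ^ C.
  have h1 : #|slow| * N <= #|{: code_type M x s C * slot M}|.
    apply: (@slow_orbits M x s C _ (fun sigma : C.-tuple bool => init M s sigma)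
              (fun sigma => tval sigma)) => [||sigma].
    - exact: val_inj.
    - move=> sigma; split; first by split; rewrite //= ?size_nseq ?size_tuple.
      have [t [o [/halts_restores_ends h _]]] := hall sigma.
      by exists o.
    - rewrite inE => /existsPn h j hj; exact: (h (Ordinal hj)).
  (* The [2 ^ C] catalytic contents are the factor that [state_count] leaves out. *)
  have h2 : 8 * #|{: code_type M x s C * slot M}| <= N * 2 ^ C.
    have := @state_count n state_slots k digits (leqnn _); rewrite -/N => h.
    rewrite card_prod !card_prod !card_ffun !card_bool !card_ord.
    apply: leq_trans (leq_mul h (leqnn (2 ^ C))).
    rewrite /state_slots /s /logspace -/(polybound k n) -/C /=.
    move: #|st M| #|{: slot M}| => a b; rewrite -/n.
    by apply: eq_leq; rewrite -[RHS]mulnA !(mulnAC _ _ b).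
  have N0 : 0 < N by rewrite expn_gt0.
  rewrite -(leq_pmul2r N0) -mulnA (mulnC (2 ^ C)).
  by apply: leq_trans h2; rewrite leq_mul2l h1.
have hbad : 8 * #|bad| <= 5 * 2 ^ C.
  have [hU _] := leq_card_setU (~: A) slow; rewrite -/bad in hU.
  have := cardsC A; rewrite card_tuple card_bool -/n -/C.
  move: cardA hU hslow; rewrite -/n -/C.
  move: #|A| #|~: A| #|slow| #|bad| (2 ^ C) => p q r t w; lia.
(* A correct answer from the first block survives the second, which can replace it only by an output
   other than ⊥; such an output is correct as well. *)
have good_answer (sigma : C.-tuple bool) ans : ans = None \/ ans = Some (L x) ->
    let a := answers x true (init M s sigma, None) ans N in
    (a = None \/ a = Some (L x)) /\ (sigma \notin bad \/ ans = Some (L x) -> a = Some (L x)).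
  move=> hans a.
  have [t [o [/halts_restores_ends ho hval]]] := hall sigma.
  have Ea : a = if fast sigma then (if o is Some b then Some b else ans) else ans.
    exact: (@answersE M x _ o sigma ans N (wfi _) ho).
  rewrite Ea; split; first by case: ifP => // _; case: hval => ->; [|right].
  case=> [|E]; last by rewrite E; case: ifP => // _; case: hval => ->.
  rewrite !inE negb_or !negbK => /andP[hs hf].
  have [t' /halts_restores_ends h'] := hA _ hs.
  by have [-> _] := ends_fun ho h'; rewrite hf.
have bl1 (tau : C'.-tuple bool) : take C tau = @block C C' 0 tau.
  by rewrite blockE ?drop0 //; lia.
have bl2 (tau : C'.-tuple bool) : take C (drop C.+1 tau) = @block C C' C.+1 tau.
  by rewrite blockE //; lia.
have final (tau : C'.-tuple bool) : exists2 o, halts_restores_with simulator x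
    (logspace k' n) tau C' o & (o = None \/ o = Some (L x)) /\
    (tau \notin @both_bad C C' bad -> o = Some (L x)).
  have := @simulator_halts x tau (size_tuple tau); rewrite -/n -/C -/s -/N -/C'.
  rewrite bl1 bl2 => h; eexists; first exact: h.
  have [a1 b1] := good_answer (block C 0 tau) None (or_introl erefl).
  have [a2 b2] := good_answer (block C C.+1 tau) _ a1.
  split=> //; rewrite inE negb_and => /orP[g|g]; apply: b2; last by left.
  by right; apply: b1; left.
split=> [tau|].
  by have [o h [h1 _]] := final tau; exists C', o.
exists (~: @both_bad C C' bad); split; first exact: card_not_both_bad.
move=> tau; rewrite inE => ht; exists C'.
by have [o h [_ /(_ ht) E]] := final tau; rewrite -E.
Qed.

Lemma simulator_fast (x : seq bool) (tau : (polybound (7 * digits.+1) (size x)).-tuple bool) :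
  halted simulator (run simulator x (logspace (7 * digits.+1) (size x)) tau
    (polybound (7 * digits.+1) (size x))).
Proof. by have [h _] := simulator_halts (size_tuple tau); rewrite /halted h. Qed.

End Simulation.

Theorem theorem6p6 : forall L : pred (seq bool), ZPtauCL L <-> ZPtauCLP L.
Proof.
move=> L; split=> [[k [M hM]]|[k [M [hM _]]]]; last by exists k, M.
exists (7 * (digits M k).+1), (simulator M k); split; first exact: simulator_decides.
exact: simulator_fast.
Qed.
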